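(* Let $(\tau_n)_{n\ge 1}$ be a sequence of positive numbers and let the prior on $F$ be the centered Gaussian distribution $W=\mathcal{N}(0,\tau_n^2\Sigma)$ on $\langle\phi\rangle$. Assume that, as $n\to\infty$, $\sigma_n=o(\tau_n)$, $\|F_0\|=o(\tau_n^2/\sigma_n)$ and $k_n=o(\tau_n^4/\sigma_n^4)$. Then $$E\left\| W(dF\mid Y)-\mathcal{N}\left(Y_{\langle\phi\rangle},\sigma_n^2\Sigma\right)\right\|_{\mathrm{TV}}\longrightarrow 0\qquad\text{as } n\to\infty .$$
   Context: For every $n\ge1$ one observes a random vector $Y=F+\varepsilon\in\mathbb{R}^n$ with $\varepsilon\sim\mathcal{N}(0,\sigma_n^2 I_n)$, where $\sigma_n>0$ is known and may depend on $n$. The true mean vector of $Y$ is $F_0\in\mathbb{R}^n$ (depending on $n$, otherwise arbitrary); $E$ denotes expectation when $Y\sim\mathcal{N}(F_0,\sigma_n^2I_n)$. Let $\Phi$ be an $n\times k_n$ real matrix of rank $k_n$ (its columns $\phi_1,\dots,\phi_{k_n}$ are the regressors), where $1\le k_n\le n$ grows with $n$; $\langle\phi\rangle=\{\Phi\theta:\theta\in\mathbb{R}^{k_n}\}$ is their linear span; it is not assumed that $F_0\in\langle\phi\rangle$. Set $\Sigma=\Phi(\Phi^T\Phi)^{-1}\Phi^T$ (orthogonal projection matrix onto $\langle\phi\rangle$) and $Y_{\langle\phi\rangle}=\Sigma Y$. $W(dF\mid Y)$ is the posterior distribution of $F$ given $Y$ when $F\sim W$ and, conditionally on $F$, $Y\sim\mathcal{N}(F,\sigma_n^2I_n)$.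 Everything (including $W$ and $\Phi$) depends on $n$. Gaussian distributions with singular covariance are allowed; $\|\cdot\|$ is the Euclidean norm on vectors and $\|Q-Q'\|_{\mathrm{TV}}=\sup_A|Q(A)-Q'(A)|$ is the total variation norm. *)

(* Defs.v *)
From HB Require Import structures.
From mathcomp Require Import all_boot all_order all_algebra.
From mathcomp Require Import all_classical all_reals all_analysis.
From mathcomp Require Import measurable_realfun.

Set Implicit Arguments.
Unset Strict Implicit.
Unset Printing Implicit Defensive.

Import Order.TTheory GRing.Theory Num.Theory.
Import numFieldNormedType.Exports.

Local Open Scope classical_set_scope.
Local Open Scope ring_scope.

(* R^n is 'cV[R]_n with the product sigma-algebra, i.e. the one generated by
   the coordinate maps. *)
Definition measure_cV_display : measure_display -> measure_display.
Proof. exact. Qed.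

Section measurable_cV.
Context {d : measure_display} {T : measurableType d}.
Variable n : nat.

Let coord : 'I_n -> 'cV[T]_n -> T := fun i x => x i ord0.

Let cV_set0 : g_sigma_preimage coord set0.
Proof. exact: sigma_algebra0. Qed.

Let cV_setC A : g_sigma_preimage coord A -> g_sigma_preimage coord (~` A).
Proof. exact: sigma_algebraC. Qed.

Let cV_bigcup (F : _^nat) : (forall i, g_sigma_preimage coord (F i)) ->
  g_sigma_preimage coord (\bigcup_i (F i)).
Proof. exact: sigma_algebra_bigcup. Qed.

HB.instance Definition _ := @isMeasurable.Build (measure_cV_display d)
  'cV[T]_n (g_sigma_preimage coord) cV_set0 cV_setC cV_bigcup.

End measurable_cV.

Lemma measurable_coord d (T : measurableType d) n (i : 'I_n) :
  measurable_fun [set: 'cV[T]_n] (fun x : 'cV[T]_n => x i ord0).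
Proof.
move=> _ Y mY; rewrite setTI; apply: sub_sigma_algebra => /=.
rewrite -bigcup_seq/=; exists i => /=; first by rewrite mem_index_enum.
by exists Y => //; rewrite setTI.
Qed.

Lemma measurable_fun_coordP d1 d2 (T1 : measurableType d1)
    (T2 : measurableType d2) n (f : T1 -> 'cV[T2]_n) :
  (forall i, measurable_fun [set: T1] (fun x => f x i ord0)) ->
  measurable_fun [set: T1] f.
Proof.
move=> mf.
suff h : g_sigma_preimage (fun (i : 'I_n) (x : T1) => f x i ord0) `<=` measurable.
  move=> _ A mA; apply: h.
  have -> : (fun (i : 'I_n) (x : T1) => f x i ord0) =
    (fun i => (fun x : 'cV[T2]_n => x i ord0) \o f) by [].
  by rewrite g_sigma_preimage_comp; exists A.
apply: smallest_sub; first exact: sigma_algebra_measurable.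
rewrite -bigcup_seq; apply: bigcup_sub => i _ A [B mB <-].
exact: mf.
Qed.

Section gaussian.
Context {R : realType}.

(* measurableTypeR R is R with its Borel sigma-algebra, in the guise in which
   it carries normal_prob. *)
Definition col_cons n (p : measurableTypeR R * 'cV[R]_n) : 'cV[R]_n.+1 :=
  \col_i (if unlift ord0 i is Some j then p.2 j ord0 else p.1).

Lemma measurable_col_cons n : measurable_fun setT (@col_cons n).
Proof.
apply: measurable_fun_coordP => i; rewrite /col_cons.
under eq_fun do rewrite mxE.
case: (unlift ord0 i) => [j|]; last exact: measurable_fst.
apply: (measurableT_comp (measurable_coord j)); exact: measurable_snd.
Qed.

HB.instance Definition _ n := isMeasurableFun.Build _ _ _ _ (@col_cons n)
  (@measurable_col_cons n).

(* N(0, I_n), the n-fold product of N(0, 1). *)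
Fixpoint std_gaussian (n : nat) : probability 'cV[R]_n R :=
  if n is n'.+1 then
    distribution (normal_prob 0 1 \x std_gaussian n')%E (@col_cons n')
  else dirac (0 : 'cV[R]_0).

Definition affine n (m : 'cV[R]_n) (A : 'M[R]_n) (z : 'cV[R]_n) : 'cV[R]_n :=
  m + A *m z.

Lemma measurable_affine n m A : measurable_fun setT (@affine n m A).
Proof.
apply: measurable_fun_coordP => i.
rewrite (_ : (fun _ => _) =
  (fun z : 'cV[R]_n => m i ord0 + \sum_(j <- index_enum 'I_n) A i j * z j ord0)).
  apply: measurable_funD => //; apply: measurable_sum => j.
  by apply: measurable_funM => //; exact: measurable_coord.
by apply/funext => z; rewrite /affine !mxE.
Qed.

HB.instance Definition _ n m A := isMeasurableFun.Build _ _ _ _ (@affine n m A)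
  (@measurable_affine n m A).

Definition psd n (A : 'M[R]_n) :=
  A^T = A /\ forall x : 'cV[R]_n, 0 <= (x^T *m A *m x) ord0 ord0.

(* The unique symmetric positive semidefinite square root of S
   (junk value 0 if S is not symmetric positive semidefinite). *)
Definition sqrtmx n (S : 'M[R]_n) : 'M[R]_n :=
  xget 0 [set A | psd A /\ A *m A = S].

(* N(m, S), S possibly singular: the law of m + S^{1/2} Z, Z ~ N(0, I_n). *)
Definition gaussian n (m : 'cV[R]_n) (S : 'M[R]_n) : probability 'cV[R]_n R :=
  distribution (std_gaussian n) (affine m (sqrtmx S)).

Definition gaussian_model n (S : 'M[R]_n) :
    'cV[R]_n -> {measure set 'cV[R]_n -> \bar R} :=
  fun m => gaussian m S.

Lemma measurable_gaussian_model n (S : 'M[R]_n) U : measurable U ->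
  measurable_fun setT (@gaussian_model n S ^~ U).
Proof.
move=> mU; pose f (p : 'cV[R]_n * 'cV[R]_n) := affine p.1 (sqrtmx S) p.2.
have mf : measurable_fun setT f.
  apply: measurable_fun_coordP => i; rewrite /f /affine.
  under eq_fun do rewrite !mxE.
  apply: measurable_funD.
    exact: (measurableT_comp (measurable_coord i) measurable_fst).
  apply: measurable_sum => j; apply: measurable_funM => //.
  exact: (measurableT_comp (measurable_coord j) measurable_snd).
have mfU : measurable (f @^-1` U) by rewrite -[_ @^-1` _]setTI; exact: mf.
suff -> : (fun m => gaussian_model S m U) = std_gaussian n \o xsection (f @^-1` U).
  exact: measurable_fun_xsection.
apply/funext => m /=; rewrite /gaussian_model /gaussian /distribution /pushforward.
by congr (std_gaussian n _); apply/seteqP; split=> z; rewrite /xsection/= inE.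
Qed.

HB.instance Definition _ n (S : 'M[R]_n) := isKernel.Build _ _ _ _ _
  (gaussian_model S) (@measurable_gaussian_model n S).

Lemma gaussian_modelT n (S : 'M[R]_n) m : gaussian_model S m setT = 1%E.
Proof. exact: probability_setT. Qed.

HB.instance Definition _ n (S : 'M[R]_n) := Kernel_isProbability.Build _ _ _ _ _
  (gaussian_model S) (@gaussian_modelT n S).

Definition enorm n (x : 'cV[R]_n) : R := Num.sqrt (\sum_i (x i ord0) ^+ 2).

Definition hat_mx n k (Phi : 'M[R]_(n, k)) : 'M[R]_n :=
  Phi *m invmx (Phi^T *m Phi) *m Phi^T.

End gaussian.

Section conditional_law.
Context {R : realType}.
Local Open Scope ereal_scope.

Definition tv_dist d (T : measurableType d) (Q Q' : {measure set T -> \bar R}) :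
    \bar R :=
  ereal_sup [set `|Q A - Q' A| | A in measurable].

(* kappa is a version of the conditional distribution of Y given X:
   P (X \in A, Y \in B) = E [1_(X \in A) kappa X B]. *)
Definition is_cond_distr d d1 d2 (Omega : measurableType d)
    (T1 : measurableType d1) (T2 : measurableType d2)
    (P : probability Omega R) (X : Omega -> T1) (Y : Omega -> T2)
    (kappa : R.-pker T1 ~> T2) :=
  forall A B, measurable A -> measurable B ->
    P (X @^-1` A `&` Y @^-1` B) = \int[P]_(w in X @^-1` A) kappa (X w) B.

(* Q is the joint law of (F, Y), with F ~ prior and Y | F ~ model F; the
   posterior is the conditional distribution of F given Y, which is determined
   up to a null set of values of Y. *)
Definition is_posterior d1 d2 (T1 : measurableType d1) (T2 : measurableType d2)
    (prior : probability T1 R) (model : R.-pker T1 ~> T2)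
    (post : R.-pker T2 ~> T1) :=
  exists Q : probability (T1 * T2)%type R,
    [/\ forall A, measurable A -> Q (fst @^-1` A) = prior A,
        is_cond_distr Q fst snd model
      & is_cond_distr Q snd fst post].

End conditional_law.

(* Main.v *)
(* The standard Gaussian law is invariant under Givens rotations, because a planar
   rotation is a product of shears and Lebesgue measure is translation invariant.
   By QR decomposition such rotations diagonalize the projection
   P = hat_mx Phi, so that computations with P reduce to the first k coordinates.

   Writing F = tau P u and Y = F + sigma w, a rotation of the pair (u, w) inside the
   range of P gives F = a P Y + b P u' with u' independent of Y, where
   a = tau^2 / (sigma^2 + tau^2) and b^2 = a sigma^2; hence the posterior is
   N(a P Y, a sigma^2 P) for almost every Y. Relative to N(P Y, sigma^2 P) this law
   has a density rho with E rho^2 <= exp x, where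
   x = (1 - a)^2 (k + |P Y|^2 / sigma^2). By AM-GM the total variation distance is
   at most t / 2 + 2 x / t for every t in (0, 1], and
   E x = O(k sigma^4 / tau^4 + (|F_0| sigma / tau^2)^2) tends to 0. *)

Require Import Defs.
From HB Require Import structures.
From mathcomp Require Import all_boot all_order all_algebra.
From mathcomp Require Import all_classical all_reals all_analysis.
From mathcomp Require Import measurable_realfun lra ring.

Set Implicit Arguments.
Unset Strict Implicit.
Unset Printing Implicit Defensive.

Import Order.TTheory GRing.Theory Num.Theory.
Import numFieldNormedType.Exports.

Local Open Scope classical_set_scope.
Local Open Scope ring_scope.

(** * Rotations of planar Gaussian laws *)

(** The exponent [x] is of second order in 1 - a because first-order effects cancel: in one
    coordinate the variance change contributes (1 - (1 - a)^2)^(-1/2) to the second moment of the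
    density, a function even in 1 - a. Hence the fourth power in the condition on [k]. The mean
    moves by (1 - a) P Y, to be compared with sigma; as 1 - a <= sigma^2 / tau^2 and E |P Y|^2 is at
    most of order |F0|^2 + k sigma^2, this gives the condition on [F0].

    The AM-GM bound is used, rather than a square root of [x], because it is linear in [x] with a
    [t] independent of Y: only E x has to be estimated, and [t] is chosen afterwards.

    A version of the posterior is determined only up to null sets of the Bayesian marginal law of Y,
    while the expectation is taken under N(F0, sigma^2 I) with [F0] possibly outside the span. The
    exceptional set is carried over by the equivalence of all the laws N(m, sigma^2 I). *)

Lemma std_normal_pdfE (R : realType) (x : R) :
  normal_pdf 0 1 x = normal_peak 1 * expR (- (x ^+ 2 / 2)).
Proof.
by rewrite normal_pdfE ?oner_neq0// /normal_fun subr0 expr1n mulNr.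
Qed.

Lemma std_normal_pdfM (R : realType) (x y : R) :
  normal_pdf 0 1 x * normal_pdf 0 1 y =
  normal_peak 1 ^+ 2 * expR (- ((x ^+ 2 + y ^+ 2) / 2)).
Proof. by rewrite !std_normal_pdfE mulrACA -expRD mulrDl opprD. Qed.

Lemma std_normal_pdf_rotation (R : realType) (c s x y : R) :
  c ^+ 2 + s ^+ 2 = 1 ->
  normal_pdf 0 1 x * normal_pdf 0 1 y =
  normal_pdf 0 1 (c * x + s * y) * normal_pdf 0 1 (- s * x + c * y).
Proof.
move=> cs; rewrite !std_normal_pdfM.
suff -> : (c * x + s * y) ^+ 2 + (- s * x + c * y) ^+ 2 = x ^+ 2 + y ^+ 2 by [].
transitivity ((c ^+ 2 + s ^+ 2) * (x ^+ 2 + y ^+ 2)); last by rewrite cs mul1r.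
by ring.
Qed.

Section univariate.
Context {R : realType}.
Local Notation rT := (measurableTypeR R).
Local Notation mu := (@lebesgue_measure R).
Local Notation N01 := (@normal_prob R 0 1).
Implicit Type h : rT -> \bar R.

(** The Radon-Nikodym derivative of the normal law and [normal_pdf] have the same integral over
    every measurable set, so they agree almost everywhere. *)
Lemma ge0_integral_normal_prob (m s : R) h :
  measurable_fun setT h -> (forall x, 0 <= h x)%E ->
  (\int[normal_prob m s]_x h x = \int[mu]_x (h x * (normal_pdf m s x)%:E))%E.
Proof.
move=> mh h0.
have dom := normal_prob_dominates m s.
rewrite -(Radon_Nikodym_SigmaFinite.change_of_variables dom)//=.
apply: ae_eq_integral => //.
- apply: emeasurable_funM => //; apply: (measurable_int mu).
  exact: Radon_Nikodym_SigmaFinite.f_integrable.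
- apply: emeasurable_funM => //; apply/measurable_EFinP.
  exact: measurable_normal_pdf.
- apply: ae_eqe_mul2l; apply: integral_ae_eq => //.
  + exact: Radon_Nikodym_SigmaFinite.f_integrable.
  + by apply/measurable_EFinP; exact: measurable_normal_pdf.
  + by move=> E _ mE; rewrite -Radon_Nikodym_SigmaFinite.f_integral.
Qed.

(** The image of Lebesgue measure under x -> m + s x, multiplied by s, gives intervals their length;
    uniqueness of Lebesgue measure does the rest. *)
Lemma ge0_integral_lebesgue_affine (m s : R) h : 0 < s ->
  measurable_fun setT h -> (forall x, 0 <= h x)%E ->
  (\int[mu]_x h x = s%:E * \int[mu]_x h (m + s * x)%R)%E.
Proof.
move=> s0 mh h0; pose phi := fun x : rT => (m + s * x : rT).
have mphi : measurable_fun setT phi.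
  by apply: measurable_funD => //; exact: measurable_funM.
pose s' := NngNum (ltW s0).
rewrite -[X in (_ * X)%E](ge0_integral_pushforward mphi mu measurableT mh)//.
rewrite -(ge0_integral_mscale _ measurableT s')//.
apply: eq_measure_integral => A mA _; apply: lebesgue_measure_unique => //.
move=> _ [[a b] _ <-].
transitivity (s%:E * mu (phi @^-1` `]a, b]))%E; last by [].
have -> : phi @^-1` `]a, b] = `](a - m) / s, (b - m) / s]%classic.
    apply/seteqP; split => x /=; rewrite !in_itv/= /phi.
      by rewrite ltr_pdivrMr// ler_pdivlMr// mulrC => /andP[? ?]; lra.
    by rewrite ltr_pdivrMr// ler_pdivlMr// mulrC => /andP[? ?]; lra.
  rewrite !lebesgue_measure_itv/= !lte_fin ltr_pM2r ?invr_gt0// ltrD2r.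
  case: ifP => _; last by rewrite mule0.
  by rewrite -!EFinB -EFinM -mulrBl mulrC divfK ?gt_eqF// opprB addrA subrK.
Qed.

Lemma ge0_integral_lebesgue_translation (m : R) h :
  measurable_fun setT h -> (forall x, 0 <= h x)%E ->
  (\int[mu]_x h (x + m)%R = \int[mu]_x h x)%E.
Proof.
move=> mh h0; rewrite (@ge0_integral_lebesgue_affine m 1 h)// mul1e.
by apply: eq_integral => x _; rewrite mul1r addrC.
Qed.



(** For fixed y the shear is a translation of x, so the order of integration is exchanged, x is
    translated in the inner integral, and the order is restored. *)
Lemma shear_integral1 (t : R) (h : rT * rT -> \bar R) :
  measurable_fun setT h -> (forall p, 0 <= h p)%E ->
  (\int[mu]_x \int[mu]_y h (x + t * y, y)%R = \int[mu]_x \int[mu]_y h (x, y))%E.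
Proof.
move=> mh h0; pose h1 (p : rT * rT) := h (p.1 + t * p.2, p.2).
have mh1 : measurable_fun setT h1.
  apply: measurableT_comp => //; apply: measurable_fun_pair => //=.
  by apply: measurable_funD => //; exact: measurable_funM.
have h10 p : (0 <= h1 p)%E by exact: h0.
transitivity (\int[mu]_x \int[mu]_y h1 (x, y))%E; first by [].
transitivity (\int[mu]_y \int[mu]_x h1 (x, y))%E.
  exact: (fubini_tonelli (m1 := mu) (m2 := mu) h1 mh1 h10).
transitivity (\int[mu]_y \int[mu]_x h (x, y))%E; last first.
  exact/esym/(fubini_tonelli (m1 := mu) (m2 := mu) h mh h0).
apply: eq_integral => y _.
apply: (ge0_integral_lebesgue_translation (t * y) (h := fun x => h (x, y))) => [|x].
  by apply: measurableT_comp => //; exact: measurable_fun_pair.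
exact: h0.
Qed.

Lemma shear_integral2 (t : R) (h : rT * rT -> \bar R) :
  measurable_fun setT h -> (forall p, 0 <= h p)%E ->
  (\int[mu]_x \int[mu]_y h (x, y + t * x)%R = \int[mu]_x \int[mu]_y h (x, y))%E.
Proof.
move=> mh h0; apply: eq_integral => x _.
rewrite (@ge0_integral_lebesgue_translation (t * x) (fun y => h (x, y)))//.
by apply: measurableT_comp => //; exact: measurable_fun_pair.
Qed.

(* A rotation of angle other than pi is the product of three shears. *)
Lemma rotation_integral_lebesgue (c s : R) (h : rT * rT -> \bar R) :
  c ^+ 2 + s ^+ 2 = 1 -> -1 < c ->
  measurable_fun setT h -> (forall p, 0 <= h p)%E ->
  (\int[mu]_x \int[mu]_y h (c * x + s * y, - s * x + c * y)%R =
   \int[mu]_x \int[mu]_y h (x, y))%E.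
Proof.
(* [t] is the tangent of half the angle. The rotation adds t y to x, then subtracts s x from y, then
   adds t y to x again; [h1] absorbs the last shear and [h2] the last two. *)
move=> cs c1 mh h0; pose t := s / (1 + c).
have tc : t * (1 + c) = s by rewrite divfK// gt_eqF//; lra.
have ts : 1 - s * t = c.
  apply: (@mulIf _ (1 + c)); first by rewrite gt_eqF//; lra.
  by rewrite mulrBl -mulrA tc; nra.
pose h1 := fun p : rT * rT => h (p.1 + t * p.2, p.2).
pose h2 := fun p : rT * rT => h1 (p.1, p.2 - s * p.1).
have mh1 : measurable_fun setT h1.
  apply: measurableT_comp => //; apply: measurable_fun_pair => //=.
  by apply: measurable_funD => //; exact: measurable_funM.
have mh2 : measurable_fun setT h2.
  apply: measurableT_comp => //; apply: measurable_fun_pair => //=.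
  by apply: measurable_funB => //; exact: measurable_funM.
have h10 p : (0 <= h1 p)%E by exact: h0.
have h20 p : (0 <= h2 p)%E by exact: h0.
transitivity (\int[mu]_x \int[mu]_y h1 (x, y))%E; last exact: shear_integral1.
transitivity (\int[mu]_x \int[mu]_y h1 (x, y + (- s) * x)%R)%E; last first.
  exact: shear_integral2.
transitivity (\int[mu]_x \int[mu]_y h2 (x + t * y, y)%R)%E.
  apply: eq_integral => x _; apply: eq_integral => y _; rewrite /h2 /h1/=.
  have xE : c * x + s * y = x + t * y + t * (y - s * (x + t * y)).
    by rewrite -[in LHS]tc -ts; ring.
  have yE : - s * x + c * y = y - s * (x + t * y) by rewrite -ts; ring.
  by rewrite xE yE.
transitivity (\int[mu]_x \int[mu]_y h2 (x, y))%E.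
  exact: shear_integral1.
by apply: eq_integral => x _; apply: eq_integral => y _; rewrite /h2 /h1/= mulNr.
Qed.

Let phi := @normal_pdf R 0 1.

Lemma iterated_normal_lebesgue (h : rT * rT -> \bar R) :
  measurable_fun setT h -> (forall p, 0 <= h p)%E ->
  (\int[N01]_x \int[N01]_y h (x, y) =
   \int[mu]_x \int[mu]_y (h (x, y) * (phi x * phi y)%:E))%E.
Proof.
move=> mh h0; have mphi : measurable_fun setT (EFin \o phi).
  by apply/measurable_EFinP; exact: measurable_normal_pdf.
have phi0 x : (0 <= (phi x)%:E)%E by rewrite lee_fin normal_pdf_ge0.
rewrite ge0_integral_normal_prob; last 2 first.
  exact: (measurable_fun_fubini_tonelli_F h).
  by move=> x; exact: integral_ge0.
apply: eq_integral => x _.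
have mhx : measurable_fun setT (fun y : rT => h (x, y)).
  by apply: measurableT_comp => //; exact: measurable_fun_pair.
rewrite ge0_integral_normal_prob// -ge0_integralZr//; last 2 first.
  exact: emeasurable_funM.
  by move=> y _; exact: mule_ge0.
by apply: eq_integral => y _; rewrite -muleA -EFinM [phi y * _]mulrC.
Qed.

(** The joint density depends on x^2 + y^2 only, so it may be rotated along with [h] and the
    Lebesgue case applies to their product. *)
Lemma rotation_integral_normal (c s : R) (h : rT * rT -> \bar R) :
  c ^+ 2 + s ^+ 2 = 1 -> -1 < c ->
  measurable_fun setT h -> (forall p, 0 <= h p)%E ->
  (\int[N01]_x \int[N01]_y h (c * x + s * y, - s * x + c * y)%R =
   \int[N01]_x \int[N01]_y h (x, y))%E.
Proof.
move=> cs c1 mh h0.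
have mrot : measurable_fun setT
    (fun p : rT * rT => (c * p.1 + s * p.2, - s * p.1 + c * p.2) : rT * rT).
  by apply: measurable_fun_pair => /=; apply: measurable_funD => //;
    exact: measurable_funM.
pose h1 (p : rT * rT) := h (c * p.1 + s * p.2, - s * p.1 + c * p.2).
have mh1 : measurable_fun setT h1 by exact: (measurableT_comp mh mrot).
have h10 p : (0 <= h1 p)%E by exact: h0.
transitivity (\int[N01]_x \int[N01]_y h1 (x, y))%E; first by [].
rewrite (iterated_normal_lebesgue mh h0) (iterated_normal_lebesgue mh1 h10).
pose H (p : rT * rT) := (h p * (phi p.1 * phi p.2)%:E)%E.
have mH : measurable_fun setT H.
  apply: emeasurable_funM => //; apply/measurable_EFinP; apply: measurable_funM.
    by apply: measurableT_comp => //; exact: measurable_normal_pdf.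
  by apply: measurableT_comp => //; exact: measurable_normal_pdf.
have H0 p : (0 <= H p)%E.
  by rewrite mule_ge0// lee_fin mulr_ge0// normal_pdf_ge0.
transitivity (\int[mu]_x \int[mu]_y H (c * x + s * y, - s * x + c * y)%R)%E; last first.
  exact: rotation_integral_lebesgue.
apply: eq_integral => x _; apply: eq_integral => y _; rewrite /H/= /h1/=.
by rewrite /phi (std_normal_pdf_rotation x y cs).
Qed.

End univariate.

(** * Invariance of the standard Gaussian law *)

Section gaussian_invariance.
Context {R : realType}.
Local Notation rT := (measurableTypeR R).
Local Notation N01 := (@normal_prob R 0 1).
Local Notation G n := (@std_gaussian R n).

Lemma col_consE n (x : rT) (z : 'cV[R]_n) :
  col_cons (x, z) = col_mx (x%:M : 'M[R]_1) z :> 'cV[R]_(1 + n).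
Proof.
apply/colP => i; rewrite mxE; case: (unliftP ord0 i) => [j|] -> /=.
  have -> : lift ord0 j = rshift 1 j by exact/val_inj.
  by rewrite col_mxEd.
have -> : ord0 = lshift n (ord0 : 'I_1) by exact/val_inj.
by rewrite col_mxEu mxE eqxx.
Qed.

Lemma measurable_col_cons2 d (T : measurableType d) n (f : T -> rT)
    (g : T -> 'cV[R]_n) : measurable_fun setT f -> measurable_fun setT g ->
  measurable_fun setT (fun t => col_cons (f t, g t)).
Proof.
move=> mf mg; apply: (measurableT_comp (@measurable_col_cons R n)).
exact: measurable_fun_pair.
Qed.

Lemma measurable_mulmx n (M : 'M[R]_n) :
  measurable_fun setT (fun z : 'cV[R]_n => M *m z).
Proof.
have -> : (fun z : 'cV[R]_n => M *m z) = affine 0 M.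
  by apply/funext => z; rewrite /affine add0r.
exact: measurable_affine.
Qed.

Lemma measurable_vecD d (T : measurableType d) n (f g : T -> 'cV[R]_n) :
  measurable_fun setT f -> measurable_fun setT g ->
  measurable_fun setT (fun t => f t + g t).
Proof.
move=> mf mg; apply: measurable_fun_coordP => i; under eq_fun do rewrite mxE.
apply: measurable_funD.
  exact: (measurableT_comp (measurable_coord i) mf).
exact: (measurableT_comp (measurable_coord i) mg).
Qed.

Lemma measurable_vecZ d (T : measurableType d) n (c : R) (f : T -> 'cV[R]_n) :
  measurable_fun setT f -> measurable_fun setT (fun t => c *: f t).
Proof.
move=> mf; apply: measurable_fun_coordP => i; under eq_fun do rewrite mxE.
apply: measurable_funM => //.
exact: (measurableT_comp (measurable_coord i) mf).
Qed.

Lemma measurable_vecB d (T : measurableType d) n (f g : T -> 'cV[R]_n) :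
  measurable_fun setT f -> measurable_fun setT g ->
  measurable_fun setT (fun t => f t - g t).
Proof.
move=> mf mg; under eq_fun do rewrite -scaleN1r.
by apply: measurable_vecD => //; exact: measurable_vecZ.
Qed.

Lemma std_gaussian_integralS n (h : 'cV[R]_n.+1 -> \bar R) :
  measurable_fun setT h -> (forall z, 0 <= h z)%E ->
  (\int[G n.+1]_z h z = \int[N01]_x \int[G n]_z h (col_cons (x, z)))%E.
Proof.
move=> mh h0; rewrite /= ge0_integral_distribution//.
rewrite fubini_tonelli1//=; exact: measurableT_comp.
Qed.

(** Invariance is phrased with integrals of nonnegative functions, the form in which it is applied
    inside iterated integrals. *)
Definition gaussian_invariant n (M : 'M[R]_n) :=
  forall h : 'cV[R]_n -> \bar R, measurable_fun setT h -> (forall z, 0 <= h z)%E ->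
  (\int[G n]_z h (M *m z) = \int[G n]_z h z)%E.

Lemma gaussian_invariant1 n : gaussian_invariant (1%:M : 'M[R]_n).
Proof. by move=> h _ _; apply: eq_integral => z _; rewrite mul1mx. Qed.

Lemma gaussian_invariantM n (M N : 'M[R]_n) :
  gaussian_invariant M -> gaussian_invariant N -> gaussian_invariant (M *m N).
Proof.
move=> iM iN h mh h0.
under eq_integral do rewrite -mulmxA.
rewrite (iN (fun z => h (M *m z)))//; first exact: iM.
exact: (measurableT_comp mh (measurable_mulmx M)).
Qed.

(** Invariance under [M], applied to z -> h (N z), cancels [N] against [M]. It serves to pass from
    an orthogonal matrix to its transpose. *)
Lemma gaussian_invariantV n (M N : 'M[R]_n) :
  N *m M = 1%:M -> gaussian_invariant M -> gaussian_invariant N.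
Proof.
move=> NM iM h mh h0; rewrite -(iM (fun z => h (N *m z)))//.
  by apply: eq_integral => z _; rewrite mulmxA NM mul1mx.
exact: (measurableT_comp mh (measurable_mulmx N)).
Qed.

Lemma gaussian_invariant_block n (M : 'M[R]_n) : gaussian_invariant M ->
  gaussian_invariant (block_mx 1%:M 0 0 M : 'M[R]_(1 + n)).
Proof.
move=> iM h mh h0; pose B : 'M[R]_n.+1 := block_mx 1%:M 0 0 M : 'M[R]_(1 + n).
have mhB : measurable_fun setT (fun z : 'cV[R]_n.+1 => h (B *m z)).
  exact: (measurableT_comp mh (measurable_mulmx _)).
apply: (etrans (std_gaussian_integralS mhB (fun z => h0 _))).
apply: (etrans _ (esym (std_gaussian_integralS mh h0))).
apply: eq_integral => x _.
rewrite -(iM (fun z => h (col_cons (x, z))))//; last first.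
  by apply: (measurableT_comp mh); exact: measurable_col_cons2.
apply: eq_integral => z _; congr h.
have E : (block_mx 1%:M 0 0 M : 'M[R]_(1 + n)) *m (col_cons (x, z) : 'cV_(1 + n)) =
    col_cons (x, M *m z) :> 'cV_(1 + n).
  by rewrite !col_consE mul_block_col mul1mx !mul0mx addr0 add0r.
exact: E.
Qed.

Definition givens n (c s : R) : 'M[R]_(1 + (1 + n)) :=
  block_mx c%:M (row_mx s%:M 0) (col_mx (- s)%:M 0) (block_mx c%:M 0 0 1%:M).

Lemma givens_col n (c s x y : R) (z : 'cV[R]_n) :
  givens n c s *m col_mx (x%:M : 'M[R]_1) (col_mx (y%:M : 'M[R]_1) z) =
  col_mx ((c * x + s * y)%:M : 'M[R]_1) (col_mx ((- s * x + c * y)%:M : 'M[R]_1) z).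
Proof.
rewrite mul_block_col mul_row_col mul_col_mx mul_block_col -!scalar_mxM !mul0mx.
by rewrite mul1mx !addr0 add0r add_col_mx add0r -!raddfD.
Qed.

Lemma givens_orth n (c s : R) : c ^+ 2 + s ^+ 2 = 1 ->
  (givens n c s)^T *m givens n c s = 1%:M.
Proof.
move=> cs; rewrite /givens tr_block_mx tr_row_mx tr_col_mx tr_block_mx.
rewrite !tr_scalar_mx !trmx0 mulmx_block mul_row_col mul_col_row.
rewrite mul_mx_row mul_row_block mul_col_mx mul_block_col mulmx_block.
rewrite -!scalar_mxM !mulmx0 !mul0mx ?mul1mx !addr0 ?add0r.
rewrite add_row_mx add_col_mx add_block_mx !addr0 !add0r -!raddfD/=.
have -> : c * c + - s * - s = 1 by rewrite -cs; ring.
have -> : s * s + c * c = 1 by rewrite -cs; ring.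
have -> : c * s + - s * c = 0 by ring.
have -> : s * c + c * - s = 0 by ring.
rewrite mulr1.
by rewrite !raddf0 row_mx0 col_mx0 -!scalar_mx_block.
Qed.

(** Only the first two coordinates move: integrating out the others leaves a function [H] on the
    plane, to which the planar rotation applies. *)
Lemma gaussian_invariant_givens n (c s : R) : c ^+ 2 + s ^+ 2 = 1 -> -1 < c ->
  gaussian_invariant (givens n c s).
Proof.
move=> cs c1 h mh h0.
pose H (p : rT * rT) : \bar R :=
  (\int[G n]_z h (col_cons (p.1, col_cons (p.2, z))))%E.
have mcons : measurable_fun setT (fun p : rT * rT * 'cV[R]_n =>
    h (col_cons (p.1.1, col_cons (p.1.2, p.2)))).
  apply: (measurableT_comp mh); apply: measurable_col_cons2.
    exact: measurableT_comp measurable_fst measurable_fst.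
  apply: measurable_col_cons2; last exact: measurable_snd.
  exact: measurableT_comp measurable_snd measurable_fst.
have mH : measurable_fun setT H.
  by apply: (measurable_fun_fubini_tonelli_F _ mcons) => ?; exact: h0.
have H0 p : (0 <= H p)%E by apply: integral_ge0 => z _; exact: h0.
have E2 (g : 'cV[R]_n.+2 -> \bar R) : measurable_fun setT g ->
    (forall z, 0 <= g z)%E -> (\int[G n.+2]_z g z =
    \int[N01]_x \int[N01]_y \int[G n]_z g (col_cons (x, col_cons (y, z))))%E.
  move=> mg g0; rewrite std_gaussian_integralS//.
  apply: eq_integral => x _; rewrite std_gaussian_integralS//.
  by apply: (measurableT_comp mg); exact: measurable_col_cons2.
have mhg : measurable_fun setT (fun z : 'cV[R]_n.+2 => h (givens n c s *m z)).
  exact: (measurableT_comp mh (measurable_mulmx _)).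
apply: (etrans (E2 _ mhg (fun z => h0 _))); apply: (etrans _ (esym (E2 _ mh h0))).
transitivity (\int[N01]_x \int[N01]_y H (c * x + s * y, - s * x + c * y)%R)%E.
  apply: eq_integral => x _; apply: eq_integral => y _; apply: eq_integral => z _.
  by rewrite !col_consE givens_col.
exact: rotation_integral_normal.
Qed.

(** Invariance is carried along with orthogonality instead of being derived from it: the matrices in
    use are built from Givens rotations by products and block extensions, which preserve both
    properties. *)
Definition gaussian_orth n (M : 'M[R]_n) :=
  gaussian_invariant M /\ M^T *m M = 1%:M.

Lemma gaussian_orth1 n : gaussian_orth (1%:M : 'M[R]_n).
Proof. by split; [exact: gaussian_invariant1|rewrite trmx1 mulmx1]. Qed.

Lemma gaussian_orthM n (M N : 'M[R]_n) :
  gaussian_orth M -> gaussian_orth N -> gaussian_orth (M *m N).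
Proof.
move=> [iM oM] [iN oN]; split; first exact: gaussian_invariantM.
by rewrite trmx_mul -mulmxA (mulmxA M^T) oM mul1mx.
Qed.

Lemma gaussian_orth_block n (M : 'M[R]_n) : gaussian_orth M ->
  gaussian_orth (block_mx 1%:M 0 0 M : 'M[R]_(1 + n)).
Proof.
move=> [iM oM]; split; first exact: gaussian_invariant_block.
rewrite tr_block_mx trmx1 !trmx0 mulmx_block !mulmx0 !mul0mx !addr0 !add0r.
by rewrite mul1mx oM -scalar_mx_block.
Qed.

(** By induction the tail of the column is reduced to its first entry [y], and one Givens rotation
    of the first two coordinates then removes [y]. *)
Lemma gaussian_orth_col n (v : 'cV[R]_(1 + n)) : exists (M : 'M[R]_(1 + n)) b,
  gaussian_orth M /\ M *m v = col_mx (b : 'M[R]_1) 0.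
Proof.
elim: n v => [|n IHn] v.
  exists 1%:M, (usubmx v); split; first exact: gaussian_orth1.
  by rewrite mul1mx -[LHS]vsubmxK [dsubmx v]flatmx0.
have [M' [b [oM' M'v]]] := IHn (dsubmx v).
pose M1 : 'M[R]_(1 + (1 + n)) := block_mx 1%:M 0 0 M'.
pose x : R := usubmx v ord0 ord0; pose y : R := b ord0 ord0.
have M1v : M1 *m v = col_mx (x%:M : 'M[R]_1) (col_mx (y%:M : 'M[R]_1) 0).
  rewrite -[in LHS](vsubmxK v) mul_block_col !mul0mx mul1mx addr0 add0r M'v.
  by rewrite -!mx11_scalar.
have oM1 : gaussian_orth M1 by exact: gaussian_orth_block.
have [y0|y0] := eqVneq y 0.
  by exists M1, x%:M; split=> //; rewrite M1v y0 raddf0 col_mx0.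
pose r := Num.sqrt (x ^+ 2 + y ^+ 2).
have r2 : r ^+ 2 = x ^+ 2 + y ^+ 2 by rewrite sqr_sqrtr// addr_ge0 ?sqr_ge0.
have r0 : 0 < r.
  by rewrite sqrtr_gt0 ltr_wpDl ?sqr_ge0// lt_def sqr_ge0 sqrf_eq0 y0.
(* The sign [e] makes the cosine e x / r nonnegative, hence larger than -1 as the rotation lemma
   requires. *)
pose e : R := if 0 <= x then 1 else -1.
have ex : 0 <= e * x.
  by rewrite /e; case: (leP 0 x) => ?; lra.
have e2 : e ^+ 2 = 1 by rewrite /e; case: ifP; rewrite ?sqrrN expr1n.
pose c := e * x / r; pose s := e * y / r.
have cs : c ^+ 2 + s ^+ 2 = 1.
  rewrite !expr_div_n -mulrDl r2 !exprMn e2 !mul1r divff//.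
  by rewrite -r2 sqrf_eq0 gt_eqF.
have c1 : -1 < c by rewrite (lt_le_trans (ltrN10 R))// divr_ge0// ltW.
exists (givens n c s *m M1), (c * x + s * y)%:M; split.
  apply: gaussian_orthM => //; split; last exact: givens_orth.
  exact: gaussian_invariant_givens.
rewrite -mulmxA M1v givens_col (_ : - s * x + c * y = 0); last first.
  by rewrite /c /s; ring.
by rewrite raddf0 col_mx0.
Qed.

(** The first column is cleared below its top entry, then the lower right block is treated
    recursively by a matrix that fixes the first coordinate. *)
Lemma gaussian_orth_QR n k (A : 'M[R]_(n, k)) : exists M : 'M[R]_n,
  gaussian_orth M /\ forall (i : 'I_n) (j : 'I_k), (j < i)%N -> (M *m A) i j = 0.
Proof.
elim: n k A => [|n IHn] k A.
  by exists 1%:M; split; [exact: gaussian_orth1|case].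
case: k A => [|k] A; first by exists 1%:M; split; [exact: gaussian_orth1|move=> i []].
have [M1 [b [oM1 M1A]]] := gaussian_orth_col (lsubmx (A : 'M[R]_(1 + n, 1 + k))).
pose A1 : 'M[R]_(1 + n, 1 + k) := M1 *m A.
have lsubM (B : 'M[R]_(1 + n, 1 + k)) : lsubmx (M1 *m B) = M1 *m lsubmx B.
  by rewrite -{1}(hsubmxK B) mul_mx_row row_mxKl.
have lA1 : lsubmx A1 = col_mx b 0 by rewrite -M1A -lsubM.
have [M' [oM' M'A]] := IHn _ (drsubmx A1).
exists ((block_mx 1%:M 0 0 M' : 'M[R]_(1 + n)) *m M1); split.
  by apply: gaussian_orthM => //; exact: gaussian_orth_block.
have E : (block_mx 1%:M 0 0 M' : 'M[R]_(1 + n)) *m A1 =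
    block_mx (ulsubmx A1) (ursubmx A1) 0 (M' *m drsubmx A1).
  rewrite -[in LHS](submxK A1) mulmx_block !mul0mx !mul1mx !addr0 !add0r.
  have dl : dsubmx (lsubmx A1) = 0 by rewrite lA1 col_mxKd.
  have -> : dlsubmx A1 = 0 by rewrite -dl; apply/matrixP => i j; rewrite !mxE.
  by rewrite mulmx0.
move=> i j ji; rewrite -mulmxA.
apply: (etrans (congr1 (fun X : 'M[R]_(1 + n, 1 + k) => X i j) E)) => /=.
move: (i : 'I_(1 + n)) (j : 'I_(1 + k)) ji => {}i {}j.
case: (split_ordP i) => i' ->; first by rewrite (ord1 i') ltn0.
case: (split_ordP j) => j' -> ji; first by rewrite block_mxEdl mxE.
by rewrite block_mxEdr; exact: M'A.
Qed.

End gaussian_invariance.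

(** * Orthogonal projections *)

Section projections.
Context {R : realType}.

Lemma mul_tr_col n (x : 'cV[R]_n) :
  (x^T *m x) ord0 ord0 = \sum_i x i ord0 ^+ 2.
Proof. by rewrite mxE; apply: eq_bigr => i _; rewrite mxE expr2. Qed.

Lemma mul_tr_col_eq0 n (x : 'cV[R]_n) : (x^T *m x) ord0 ord0 = 0 -> x = 0.
Proof.
rewrite mul_tr_col => /eqP; rewrite psumr_eq0 => [/allP x0|i _]; last exact: sqr_ge0.
apply/colP => i; rewrite mxE; apply/eqP; rewrite -sqrf_eq0.
by apply: x0; rewrite mem_index_enum.
Qed.

Lemma mulmx_cols_eq0 m n (A : 'M[R]_(m, n)) : (forall x : 'cV_n, A *m x = 0) -> A = 0.
Proof.
move=> A0; apply/matrixP => i j; have /colP/(_ i) := A0 (delta_mx j 0).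
by rewrite -colE !mxE.
Qed.

(** For symmetric [A], |A x|^2 = x^T A^2 x. *)
Lemma sym_sqr_eq0 n (A : 'M[R]_n) : A^T = A -> A *m A = 0 -> A = 0.
Proof.
move=> sA A2; apply: mulmx_cols_eq0 => x; apply: mul_tr_col_eq0.
by rewrite trmx_mul sA mulmxA -(mulmxA _ A A) A2 mulmx0 mul0mx mxE.
Qed.

Definition orth_proj n (P : 'M[R]_n) := P^T = P /\ P *m P = P.

Lemma orth_proj1 n : orth_proj (1%:M : 'M[R]_n).
Proof. by split; rewrite ?trmx1 ?mulmx1. Qed.

Lemma orth_proj_psd n (P : 'M[R]_n) c : 0 <= c -> orth_proj P -> psd (c *: P).
Proof.
move=> c0 [sP P2]; split; first by rewrite linearZ/= sP.
move=> x; rewrite -scalemxAr -scalemxAl mxE mulr_ge0//.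
have -> : x^T *m P *m x = (P *m x)^T *m (P *m x).
  by rewrite trmx_mul sP mulmxA -(mulmxA _ P P) P2.
by rewrite mul_tr_col sumr_ge0// => i _; exact: sqr_ge0.
Qed.

(** [sqrtmx] is a choice, so uniqueness of the root is the point. A root [A] commutes with [P], a
    multiple of A^2, and the difference D = A - c P satisfies (A + c P) D = 0. For y = D x this
    gives y^T A y + c |y|^2 = 0 with both terms nonnegative, so y = 0. *)
Lemma sqrtmx_orth_proj n (P : 'M[R]_n) c : 0 <= c -> orth_proj P ->
  sqrtmx (c ^+ 2 *: P) = c *: P.
Proof.
move=> c0 pP; have [sP P2] := pP; apply: xget_unique.
  split; first exact: orth_proj_psd.
  by rewrite -scalemxAr -scalemxAl scalerA P2 -expr2.
move=> A [[sA posA] A2]; have [c_eq0|cn0] := eqVneq c 0.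
  rewrite c_eq0 scale0r; apply: sym_sqr_eq0 => //.
  by rewrite A2 c_eq0 expr0n/= scale0r.
have c2n0 : c ^+ 2 != 0 by rewrite sqrf_eq0.
have PE : P = (c ^+ 2)^-1 *: (A *m A) by rewrite A2 scalerA mulVf// scale1r.
have AP : A *m P = P *m A by rewrite PE -scalemxAr -scalemxAl mulmxA.
(* A - A P is symmetric and its square vanishes, because A^2 P = A^2. *)
have APA : A *m P = A.
  apply/eqP; rewrite eq_sym -subr_eq0; apply/eqP; apply: sym_sqr_eq0.
    by rewrite linearB/= trmx_mul sA sP AP.
  have e1 : A *m (A *m P) = A *m A by rewrite mulmxA A2 -scalemxAl P2.
  have e2 : A *m P *m A = A *m A by rewrite -mulmxA -AP e1.
  have e3 : A *m P *m (A *m P) = A *m A by rewrite mulmxA e2 -mulmxA e1.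
  by rewrite mulmxBr !mulmxBl e1 e2 e3 !subrr.
have PA : P *m A = A by rewrite -AP.
pose D := A - c *: P.
have sD : D^T = D by rewrite linearB/= linearZ/= sA sP.
have PD : P *m D = D by rewrite mulmxBr PA -scalemxAr P2.
have ABD : (A + c *: P) *m D = 0.
  rewrite mulmxBr !mulmxDl -!scalemxAr -!scalemxAl A2 APA PA P2 scalerA -expr2.
  by rewrite [X in X - _]addrC subrr.
suff : D = 0 by move=> /eqP; rewrite subr_eq0 => /eqP.
apply: mulmx_cols_eq0 => x; apply: mul_tr_col_eq0; set y := D *m x.
have : (y^T *m ((A + c *: P) *m y)) ord0 ord0 = 0.
  by rewrite mulmxA -(mulmxA _ _ y) /y (mulmxA _ D x) ABD mul0mx mulmx0 mxE.
have Py : P *m y = y by rewrite /y mulmxA PD.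
rewrite mulmxDl mulmxDr -scalemxAl Py -scalemxAr mxE [X in _ + X]mxE => yy.
have := posA y; rewrite -mulmxA => yAy.
have yy0 : 0 <= (y^T *m y) ord0 ord0.
  by rewrite mul_tr_col sumr_ge0// => i _; exact: sqr_ge0.
have cyy : 0 <= c * (y^T *m y) ord0 ord0 by rewrite mulr_ge0.
have : c * (y^T *m y) ord0 ord0 = 0 by lra.
by move=> /eqP; rewrite mulf_eq0 (negbTE cn0)/= => /eqP.
Qed.

(** If u Phi^T Phi = 0 then |Phi u^T|^2 = 0, and full column rank forces u = 0. *)
Lemma gram_unitmx n k (Phi : 'M[R]_(n, k)) : \rank Phi = k ->
  Phi^T *m Phi \in unitmx.
Proof.
move=> rk; rewrite -row_free_unit -kermx_eq0; apply/eqP.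
apply/row_matrixP => i; rewrite row0; set u := row i _.
have uk : u *m (Phi^T *m Phi) = 0 by rewrite /u -row_mul mulmx_ker row0.
have : Phi *m u^T = 0.
  apply: mul_tr_col_eq0; rewrite trmx_mul trmxK mulmxA -(mulmxA u) uk.
  by rewrite mul0mx mxE.
move=> /(congr1 trmx); rewrite trmx_mul trmxK trmx0 => uPhi.
have fPhi : row_free Phi^T by rewrite /row_free mxrank_tr rk.
by apply: (row_free_inj fPhi); rewrite uPhi mul0mx.
Qed.

Lemma hat_mx_orth_proj n k (Phi : 'M[R]_(n, k)) : \rank Phi = k ->
  orth_proj (hat_mx Phi).
Proof.
move=> rk; have uG := gram_unitmx rk; split.
  rewrite /hat_mx !trmx_mul trmxK trmx_inv trmx_mul trmxK mulmxA //.
by rewrite /hat_mx !mulmxA -(mulmxA _ Phi^T Phi) mulmxKV.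
Qed.

(** Take [M] from the QR reduction: M Phi is supported on its first k rows. The conjugated
    projection [Q] therefore has its range in that of D = [pid_mx k]; both have rank k, so the
    ranges coincide and so do the projections. *)
Lemma hat_mx_diag n k (Phi : 'M[R]_(n, k)) : \rank Phi = k ->
  exists M : 'M[R]_n, gaussian_orth M /\ M *m hat_mx Phi *m M^T = pid_mx k.
Proof.
move=> rk; have [P PE] : exists P, P = hat_mx Phi by exists (hat_mx Phi).
have := hat_mx_orth_proj rk; rewrite -PE => -[sP P2].
have [M [oM MPhi]] := gaussian_orth_QR Phi; exists M; split=> //.
have [_ MTM] := oM; have MMT := mulmx1C MTM.
set Q := _ *m M^T; set D := pid_mx k.
have kn : (k <= n)%N by rewrite -rk rank_leq_row.
have sQ : Q^T = Q by rewrite /Q trmx_mul trmxK trmx_mul sP mulmxA.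
have Q2 : Q *m Q = Q.
  by rewrite /Q -!mulmxA (mulmxA M^T) MTM mul1mx (mulmxA P) P2.
have sD : D^T = D by rewrite tr_pid_mx.
have DM : D *m (M *m Phi) = M *m Phi.
  apply/matrixP => i j; rewrite mxE (bigD1 i)//= big1 ?addr0 => [|l li]; last first.
    by rewrite mxE eq_sym (inj_eq val_inj) (negbTE li) mul0r.
  rewrite mxE eqxx/=; case: ltnP => [_|ki]; first by rewrite mul1r.
  by rewrite mul0r MPhi// (leq_trans _ ki).
have DQ : D *m Q = Q by rewrite /Q PE /hat_mx !mulmxA -(mulmxA D) DM.
have QD : Q *m D = Q by apply: trmx_inj; rewrite trmx_mul sD sQ DQ.
have rQ : \rank Q = k.
  apply/eqP; rewrite eqn_leq; apply/andP; split.
    by rewrite -QD (leq_trans (mxrankM_maxr _ _))// rank_pid_mx.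
  have uPhi : P *m Phi = Phi by rewrite PE /hat_mx -mulmxA mulmxKV// gram_unitmx.
  have -> : k = \rank (M^T *m Q *m (M *m Phi)).
    by rewrite /Q !mulmxA MTM mul1mx -(mulmxA P) MTM mulmx1 uPhi.
  by rewrite (leq_trans (mxrankM_maxl _ _))// mxrankM_maxr.
have QsubD : (Q <= D)%MS by rewrite -QD submxMl.
have /eqmxP/eqmx_sym : (Q == D)%MS.
  by rewrite -(mxrank_leqif_eq QsubD) rQ rank_pid_mx.
(* Equality of row spaces gives D = X Q, hence D Q = D; and D Q = Q was shown above. *)
move=> DQe; have /submxP[X DE] : (D <= Q)%MS by rewrite DQe.
have DQD : D *m Q = D by rewrite {1}DE -mulmxA Q2 -DE.
by rewrite -DQ DQD.
Qed.

End projections.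

(** * Rotations mixing two independent Gaussian vectors *)

Section pair_rotation.
Context {R : realType}.
Local Notation rT := (measurableTypeR R).
Local Notation N01 := (@normal_prob R 0 1).
Local Notation G n := (@std_gaussian R n).

Definition coord_comb n (c s : 'I_n -> R) (u v : 'cV[R]_n) : 'cV[R]_n :=
  \col_i (c i * u i ord0 + s i * v i ord0).

Lemma coord_comb_cons n (c s : 'I_n.+1 -> R) x y (u v : 'cV[R]_n) :
  coord_comb c s (col_cons (x, u)) (col_cons (y, v)) =
  col_cons (c ord0 * x + s ord0 * y,
    coord_comb (c \o lift ord0) (s \o lift ord0) u v).
Proof.
apply/colP => i; rewrite !mxE; case: (unliftP ord0 i) => [j|] -> /=.
  by rewrite [RHS]mxE.
by [].
Qed.

Lemma measurable_coord_comb n (c s : 'I_n -> R) d (T : measurableType d)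
    (f g : T -> 'cV[R]_n) : measurable_fun setT f -> measurable_fun setT g ->
  measurable_fun setT (fun t => coord_comb c s (f t) (g t)).
Proof.
move=> mf mg; apply: measurable_fun_coordP => i; rewrite /coord_comb.
under eq_fun do rewrite mxE.
apply: measurable_funD; apply: measurable_funM => //.
  exact: (measurableT_comp (measurable_coord i) mf).
exact: (measurableT_comp (measurable_coord i) mg).
Qed.

(** The first coordinates of both vectors come to the outside, next to each other, ready for a
    planar rotation; this exchanges the tail of the first vector with the head of the second. *)
Lemma pair_gaussian_integralS n (h : 'cV[R]_n.+1 * 'cV[R]_n.+1 -> \bar R) :
  measurable_fun setT h -> (forall p, 0 <= h p)%E ->
  (\int[G n.+1]_u \int[G n.+1]_v h (u, v) =
   \int[N01]_x \int[N01]_y \int[G n]_u \int[G n]_v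
     h (col_cons (x, u), col_cons (y, v)))%E.
Proof.
move=> mh h0.
have mhu : measurable_fun setT (fun u => \int[G n.+1]_v h (u, v))%E.
  exact: (measurable_fun_fubini_tonelli_F _ mh).
have hu0 u : (0 <= \int[G n.+1]_v h (u, v))%E by apply: integral_ge0 => v _.
apply: (etrans (std_gaussian_integralS mhu hu0)); apply: eq_integral => x _.
transitivity (\int[G n]_u \int[N01]_y \int[G n]_v
    h (col_cons (x, u), col_cons (y, v)))%E.
  apply: eq_integral => u _.
  have mhv : measurable_fun setT (fun v => h (col_cons (x, u), v)).
    by apply: (measurableT_comp mh); exact: measurable_fun_pair.
  exact: (std_gaussian_integralS mhv (fun v => h0 _)).
pose f (p : 'cV[R]_n * rT) : \bar R :=
  (\int[G n]_v h (col_cons (x, p.1), col_cons (p.2, v)))%E.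
have mf : measurable_fun setT f.
  have mf' : measurable_fun setT (fun q : 'cV[R]_n * rT * 'cV[R]_n =>
      h (col_cons (x, q.1.1), col_cons (q.1.2, q.2))).
    apply: (measurableT_comp mh); apply: measurable_fun_pair.
      apply: measurable_col_cons2 => //.
      exact: measurableT_comp measurable_fst measurable_fst.
    apply: measurable_col_cons2; last exact: measurable_snd.
    exact: measurableT_comp measurable_snd measurable_fst.
  exact: (measurable_fun_fubini_tonelli_F _ mf' (fun q => h0 _)).
have f0 p : (0 <= f p)%E by apply: integral_ge0 => v _; exact: h0.
exact: (fubini_tonelli (m1 := G n) (m2 := N01) f mf f0).
Qed.

(** Each pair (u_i, v_i) is rotated by its own angle, independently of the others. Angles depending
    on i allow a rotation on some coordinates and the identity on the rest. *)
Lemma pair_rotation n (c s : 'I_n -> R) (h : 'cV[R]_n * 'cV[R]_n -> \bar R) :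
  (forall i, c i ^+ 2 + s i ^+ 2 = 1) -> (forall i, -1 < c i) ->
  measurable_fun setT h -> (forall p, 0 <= h p)%E ->
  (\int[G n]_u \int[G n]_v
     h (coord_comb c s u v, coord_comb (fun i => - s i)%R c u v) =
   \int[G n]_u \int[G n]_v h (u, v))%E.
Proof.
elim: n c s h => [|n IHn] c s h cs c1 mh h0.
  apply: eq_integral => u _; apply: eq_integral => v _.
  by congr (h (_, _)); rewrite [LHS]flatmx0 [RHS]flatmx0.
pose h' (p : 'cV[R]_n.+1 * 'cV[R]_n.+1) :=
  h (coord_comb c s p.1 p.2, coord_comb (fun i => - s i) c p.1 p.2).
have mh' : measurable_fun setT h'.
  apply: (measurableT_comp mh); apply: measurable_fun_pair;
  by apply: measurable_coord_comb; [exact: measurable_fst|exact: measurable_snd].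
apply: (etrans (pair_gaussian_integralS mh' (fun p => h0 _))).
apply: (etrans _ (esym (pair_gaussian_integralS mh h0))).
pose H (p : rT * rT) : \bar R := (\int[G n]_u \int[G n]_v
    h (col_cons (p.1, u), col_cons (p.2, v)))%E.
have mK : measurable_fun setT (fun q : rT * rT * 'cV[R]_n * 'cV[R]_n =>
    h (col_cons (q.1.1.1, q.1.2), col_cons (q.1.1.2, q.2))).
  apply: (measurableT_comp mh); apply: measurable_fun_pair.
    apply: measurable_col_cons2.
      apply: (measurableT_comp measurable_fst).
      exact: measurableT_comp measurable_fst measurable_fst.
    exact: measurableT_comp measurable_snd measurable_fst.
  apply: measurable_col_cons2; last exact: measurable_snd.
  apply: (measurableT_comp measurable_snd).
  exact: measurableT_comp measurable_fst measurable_fst.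
have mK1 := measurable_fun_fubini_tonelli_F (m2 := G n) _ mK (fun q => h0 _).
have mH : measurable_fun setT H.
  apply: (measurable_fun_fubini_tonelli_F (m2 := G n) _ mK1) => q.
  by apply: integral_ge0 => v _; exact: h0.
have H0 p : (0 <= H p)%E.
  by apply: integral_ge0 => u _; apply: integral_ge0 => v _; exact: h0.
apply: (etrans _ (rotation_integral_normal (cs ord0) (c1 ord0) mH H0)).
apply: eq_integral => x _; apply: eq_integral => y _.
pose g (p : 'cV[R]_n * 'cV[R]_n) :=
  h (col_cons (c ord0 * x + s ord0 * y, p.1),
     col_cons (- s ord0 * x + c ord0 * y, p.2)).
have mg : measurable_fun setT g.
  apply: (measurableT_comp mh); apply: measurable_fun_pair;
  by apply: measurable_col_cons2.
apply: (etrans _ (IHn (c \o lift ord0) (s \o lift ord0) g _ _ mg (fun p => h0 _))).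
- apply: eq_integral => u _; apply: eq_integral => v _.
  by rewrite /h'/= !coord_comb_cons.
- by move=> i; exact: cs.
- by move=> i; exact: c1.
Qed.

Lemma gaussian_invariant_pair n (M : 'M[R]_n)
    (h : 'cV[R]_n * 'cV[R]_n -> \bar R) : gaussian_invariant M ->
  measurable_fun setT h -> (forall p, 0 <= h p)%E ->
  (\int[G n]_u \int[G n]_v h (M *m u, M *m v) =
   \int[G n]_u \int[G n]_v h (u, v))%E.
Proof.
move=> iM mh h0.
have mhu : measurable_fun setT (fun u => \int[G n]_v h (u, v))%E.
  exact: (measurable_fun_fubini_tonelli_F _ mh).
rewrite -(iM _ mhu); last by move=> u; exact: integral_ge0.
apply: eq_integral => u _; apply: (iM (fun v => h (M *m u, v))) => //.
by apply: (measurableT_comp mh); exact: measurable_fun_pair.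
Qed.

Lemma pid_mx_col n k (u : 'cV[R]_n) :
  pid_mx k *m u = \col_i ((i < k)%:R * u i ord0).
Proof.
apply/colP => i; rewrite !mxE (bigD1 i)//= big1 ?addr0 => [|l li].
  by rewrite mxE eqxx.
by rewrite mxE eq_sym (inj_eq val_inj) (negbTE li) mul0r.
Qed.

(** In the coordinates given by [M] the projection keeps the first k entries, so this is
    [pair_rotation] with a common angle there and angle 0 (cosine 1, sine 0) beyond k. *)
Lemma proj_rotation n k (M P : 'M[R]_n) (c s : R)
    (h : 'cV[R]_n * 'cV[R]_n -> \bar R) :
  gaussian_orth M -> M *m P *m M^T = pid_mx k ->
  c ^+ 2 + s ^+ 2 = 1 -> -1 < c ->
  measurable_fun setT h -> (forall p, 0 <= h p)%E ->
  (\int[G n]_u \int[G n]_v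
     h (c *: (P *m u) + (u - P *m u) + s *: (P *m v),
        - s *: (P *m u) + c *: (P *m v) + (v - P *m v))%R =
   \int[G n]_u \int[G n]_v h (u, v))%E.
Proof.
move=> [iM MTM] MP cs c1 mh h0; set N := M^T.
have iN : gaussian_invariant N by exact: gaussian_invariantV iM.
have PN : P *m N = N *m pid_mx k by rewrite -MP !mulmxA MTM mul1mx.
pose h' (p : 'cV[R]_n * 'cV[R]_n) :=
  h (c *: (P *m p.1) + (p.1 - P *m p.1) + s *: (P *m p.2),
     - s *: (P *m p.1) + c *: (P *m p.2) + (p.2 - P *m p.2)).
pose hN (p : 'cV[R]_n * 'cV[R]_n) := h (N *m p.1, N *m p.2).
have mP1 : measurable_fun setT (fun p : 'cV[R]_n * 'cV[R]_n => P *m p.1).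
  exact: (measurableT_comp (measurable_mulmx P) measurable_fst).
have mP2 : measurable_fun setT (fun p : 'cV[R]_n * 'cV[R]_n => P *m p.2).
  exact: (measurableT_comp (measurable_mulmx P) measurable_snd).
have mh' : measurable_fun setT h'.
  apply: (measurableT_comp mh); apply: measurable_fun_pair;
    apply: measurable_vecD => //.
  - apply: measurable_vecD; last exact: measurable_vecB.
    exact: measurable_vecZ.
  - exact: measurable_vecZ.
  - by apply: measurable_vecD; exact: measurable_vecZ.
  - exact: measurable_vecB.
have mhN : measurable_fun setT hN.
  apply: (measurableT_comp mh); apply: measurable_fun_pair.
    exact: (measurableT_comp (measurable_mulmx N) measurable_fst).
  exact: (measurableT_comp (measurable_mulmx N) measurable_snd).
apply: (etrans (esym (gaussian_invariant_pair iN mh' (fun p => h0 _)))).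
apply: (etrans _ (gaussian_invariant_pair iN mh h0)).
pose c' (i : 'I_n) := if (i < k)%N then c else 1.
pose s' (i : 'I_n) := if (i < k)%N then s else 0.
apply: (etrans _ (@pair_rotation n c' s' hN _ _ mhN (fun p => h0 _))).
- apply: eq_integral => u _; apply: eq_integral => v _; rewrite /h' /hN/=.
  set D : 'M[R]_n := pid_mx k in PN *.
  have <- : c *: (D *m u) + (u - D *m u) + s *: (D *m v) = coord_comb c' s' u v.
    rewrite !pid_mx_col; apply/colP => i; rewrite !mxE /c' /s'.
    by case: ifP => _; rewrite ?mul1r ?mul0r; ring.
  have <- : - s *: (D *m u) + c *: (D *m v) + (v - D *m v) =
      coord_comb (fun i => - s' i) c' u v.
    rewrite !pid_mx_col; apply/colP => i; rewrite !mxE /c' /s'.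
    by case: ifP => _; rewrite ?mul1r ?mul0r; ring.
  by rewrite !(mulmxA P) PN -!mulmxA !(mulmxDr, mulmxN) -!scalemxAr.
- by move=> i; rewrite /c' /s'; case: ifP => _ //; rewrite expr1n expr0n addr0.
- by move=> i; rewrite /c'; case: ifP => _ //; lra.
Qed.

End pair_rotation.

(** * Gaussian densities *)

Lemma integral_cst_probability d (T : measurableType d) (R : realType)
  (P : probability T R) (r : \bar R) : (\int[P]_x r = r)%E.
Proof. by rewrite integral_cst// -[X in (_ * X)%E]/(P setT) probability_setT mule1. Qed.

Section gaussian_density.
Context {R : realType}.
Local Notation rT := (measurableTypeR R).
Local Notation mu := (@lebesgue_measure R).
Local Notation N01 := (@normal_prob R 0 1).
Local Notation G n := (@std_gaussian R n).

(** The integrand is s times the density of N(m, s^2), with s = b^(-1/2). *)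
Lemma integral_expR_quadratic (m b : R) : 0 < b ->
  (\int[mu]_x (normal_peak 1 * expR (- (b / 2) * (x - m) ^+ 2))%:E =
   (Num.sqrt b)^-1%:E)%E.
Proof.
move=> b0; pose s := (Num.sqrt b)^-1.
have sb0 : 0 < Num.sqrt b by rewrite sqrtr_gt0.
have s0 : 0 < s by rewrite invr_gt0.
have s2 : s ^+ 2 = b^-1 by rewrite exprVn sqr_sqrtr// ltW.
have E x : normal_peak 1 * expR (- (b / 2) * (x - m) ^+ 2) =
    s * normal_pdf m s x :> R.
  rewrite normal_pdfE ?gt_eqF// /normal_fun s2.
  have -> : normal_peak s = s^-1 * normal_peak 1 :> R.
    rewrite /normal_peak expr1n mul1r -mulrnAr sqrtrM ?sqr_ge0//.
    by rewrite sqrtr_sqr gtr0_norm// invfM.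
  rewrite !mulrA divff ?gt_eqF// mul1r; congr (_ * expR _).
  by rewrite -mulr_natr; field; rewrite gt_eqF.
under eq_integral do rewrite E EFinM.
rewrite ge0_integralZl//.
- by rewrite integral_normal_pdf mule1.
- by apply/measurable_EFinP; exact: measurable_normal_pdf.
- by move=> x _; rewrite lee_fin normal_pdf_ge0.
- by rewrite lee_fin ltW.
Qed.

(* Density of N(m, s^2) with respect to N(0, 1). *)
Definition normal_ratio (m s x : R) : R :=
  s^-1 * expR (x ^+ 2 / 2 - ((x - m) / s) ^+ 2 / 2).

Lemma normal_ratio_ge0 m s x : 0 < s -> 0 <= normal_ratio m s x.
Proof. by move=> s0; rewrite mulr_ge0 ?expR_ge0// invr_ge0 ltW. Qed.

Lemma measurable_normal_ratio m s :
  measurable_fun setT (normal_ratio m s : rT -> R).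
Proof.
apply: measurable_funM => //; apply: measurableT_comp => //.
apply: measurable_funB; apply: measurable_funM => //.
apply: measurable_funX; apply: measurable_funM => //.
exact: measurable_funB.
Qed.

Lemma normal_ratio01 x : normal_ratio 0 1 x = 1.
Proof. by rewrite /normal_ratio subr0 divr1 subrr expR0 invr1 mulr1. Qed.

Lemma normal_ratio_pdf m s x :
  normal_ratio m s x * normal_pdf 0 1 x = s^-1 * normal_pdf 0 1 ((x - m) / s).
Proof.
rewrite !std_normal_pdfE /normal_ratio -mulrA; congr (_ * _).
by rewrite mulrCA -expRD addrAC subrr add0r.
Qed.

Lemma integral_normal_affine m s (g : rT -> \bar R) : 0 < s ->
  measurable_fun setT g -> (forall x, 0 <= g x)%E ->
  (\int[N01]_x g (m + s * x)%R = \int[N01]_x (g x * (normal_ratio m s x)%:E))%E.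
Proof.
move=> s0 mg g0.
pose k (x : rT) : \bar R := (g x * (normal_pdf 0 1 ((x - m) / s))%:E)%E.
have mpdf : measurable_fun setT (fun x : rT => (normal_pdf 0 1 ((x - m) / s))%:E).
  apply/measurable_EFinP; apply: (measurableT_comp (measurable_normal_pdf 0 1)).
  by apply: measurable_funM => //; exact: measurable_funB.
have mk : measurable_fun setT k by exact: emeasurable_funM.
have k0 x : (0 <= k x)%E by rewrite mule_ge0// lee_fin normal_pdf_ge0.
have mga : measurable_fun setT (fun x : rT => g (m + s * x)).
  by apply: (measurableT_comp mg); apply: measurable_funD.
have mr : measurable_fun setT (fun x : rT => (g x * (normal_ratio m s x)%:E)%E).
  by apply: emeasurable_funM => //; apply/measurable_EFinP;
    exact: measurable_normal_ratio.
have r0 x : (0 <= g x * (normal_ratio m s x)%:E)%E.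
  by rewrite mule_ge0// lee_fin normal_ratio_ge0.
apply: (etrans (ge0_integral_normal_prob 0 1 mga (fun x => g0 _))).
apply: (etrans _ (esym (ge0_integral_normal_prob 0 1 mr r0))).
transitivity ((s^-1)%:E * \int[mu]_x k x)%E.
  rewrite (ge0_integral_lebesgue_affine m s0 mk k0) muleA -EFinM mulVf ?gt_eqF//.
  have xE (x : R) : (m + s * x - m) / s = x.
    by rewrite addrC addKr mulrC mulKf// gt_eqF.
  by rewrite mul1e; apply: eq_integral => x _; rewrite /k xE.
rewrite -ge0_integralZl//; last by rewrite lee_fin invr_ge0 ltW.
apply: eq_integral => x _; rewrite -muleA -EFinM normal_ratio_pdf EFinM /k.
by rewrite muleCA.
Qed.

Lemma integral_normal_ratio_sqr m s : 0 < s -> s ^+ 2 < 2 ->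
  (\int[N01]_x (normal_ratio m s x ^+ 2)%:E =
   (s ^- 2 * expR (m ^+ 2 / (2 - s ^+ 2)) / Num.sqrt (2 / s ^+ 2 - 1))%:E)%E.
Proof.
move=> s0 s2; set a := s ^+ 2 in s2 *.
have a0 : 0 < a by rewrite exprn_gt0.
set b := 2 / a - 1; have b0 : 0 < b by rewrite subr_gt0 ltr_pdivlMr// mul1r.
have mr : measurable_fun setT (fun x : rT => (normal_ratio m s x ^+ 2)%:E).
  by apply/measurable_EFinP; apply: measurable_funX; exact: measurable_normal_ratio.
rewrite ge0_integral_normal_prob//; last by move=> x; rewrite lee_fin sqr_ge0.
(* Completing the square in x^2 / 2 - (x - m)^2 / a gives -(b / 2) (x - m')^2 + m^2 / (2 - a); the
   hypothesis s^2 < 2 is what makes b positive. *)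
pose m' := 2 * m / (2 - a).
have a2 : 2 - a != 0 by rewrite gt_eqF// subr_gt0.
have E x : normal_ratio m s x ^+ 2 * normal_pdf 0 1 x =
    a^-1 * expR (m ^+ 2 / (2 - a)) *
    (normal_peak 1 * expR (- (b / 2) * (x - m') ^+ 2)).
  rewrite std_normal_pdfE /normal_ratio exprMn exprVn -/a -expRM_natl.
  rewrite mulrACA -expRD [RHS]mulrACA -expRD; congr (_ * expR _).
  rewrite expr_div_n -/a /b /m'; field.
  by rewrite a2 gt_eqF.
under eq_integral do rewrite -EFinM E EFinM.
rewrite ge0_integralZl//.
- by rewrite integral_expR_quadratic// -EFinM.
- apply/measurable_EFinP; apply: measurable_funM => //.
  apply: measurableT_comp => //; apply: measurable_funM => //.
  by apply: measurable_funX; exact: measurable_funB.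
- by move=> x _; rewrite lee_fin mulr_ge0 ?expR_ge0// normal_peak_ge0.
- by rewrite lee_fin mulr_ge0 ?expR_ge0// invr_ge0 ltW.
Qed.

(** With a = 1 - e the prefactor equals (2 a - a^2)^(-1/2) = (1 - e^2)^(-1/2), free of a term linear
    in e, and 2 - a = 1 + e >= 1 bounds the exponent by m^2. *)
Lemma integral_normal_ratio_sqr_le m s e : 0 < s -> s ^+ 2 = 1 - e -> 0 <= e ->
  e ^+ 2 <= 2^-1 ->
  (\int[N01]_x (normal_ratio m s x ^+ 2)%:E <= (expR (e ^+ 2 + m ^+ 2))%:E)%E.
Proof.
move=> s0 s2 e0 e2; have a0 : 0 < s ^+ 2 by rewrite exprn_gt0.
rewrite integral_normal_ratio_sqr//; last by lra.
rewrite lee_fin; set a := s ^+ 2 in s2 a0 *; rewrite expRD mulrAC.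
rewrite ler_pM ?expR_ge0//.
- by rewrite divr_ge0 ?sqrtr_ge0// invr_ge0 ltW.
- have b0 : 0 < 2 / a - 1 by rewrite subr_gt0 ltr_pdivlMr// mul1r; lra.
  have b1 : 0 < Num.sqrt (2 / a - 1) by rewrite sqrtr_gt0.
  have X0 : 0 < a * Num.sqrt (2 / a - 1) by rewrite mulr_gt0.
  have X2 : (a * Num.sqrt (2 / a - 1)) ^+ 2 = 1 - e ^+ 2.
    rewrite exprMn sqr_sqrtr ?ltW// mulrBr mulr1.
    have -> : a ^+ 2 * (2 / a) = 2 * a by field; rewrite gt_eqF.
    by rewrite s2; ring.
  rewrite -invfM -[leLHS]mulr1 ler_pdivrMl//.
  rewrite -(@ler_pXn2r _ 2) ?nnegrE ?ler01//; last first.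
    by rewrite mulr_ge0 ?expR_ge0// (ltW X0).
  rewrite expr1n exprMn X2 -expRM_natl.
  (* With f = e^2 and E = exp (2 f): (1 - f) (1 + 2 f) = 1 + f (1 - 2 f) >= 1, whence the bound 1/2
     on e^2. *)
  have key (f E : R) : 0 <= f -> f <= 2^-1 -> 1 + 2 * f <= E -> 1 <= (1 - f) * E.
    by move=> *; nra.
  by apply: key => //; [exact: sqr_ge0|exact: expR_ge1Dx].
- rewrite ler_expR ler_pdivrMr; last by lra.
  rewrite ler_peMr ?sqr_ge0//; lra.
Qed.

Lemma integral_std_normal_sqr_le : exists2 C : R, 0 < C &
  (\int[N01]_x (x ^+ 2)%:E <= C%:E)%E.
Proof.
(* Any finite constant suffices. From x^2 <= 4 exp (x^2 / 4), the integrand is at most 4 times a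
   Gaussian with quadratic coefficient b = 1/2. *)
exists (4 * (Num.sqrt (2^-1 : R))^-1); first by rewrite mulr_gt0 ?invr_gt0 ?sqrtr_gt0.
have m2 : measurable_fun setT (fun x : rT => (x ^+ 2)%:E).
  by apply/measurable_EFinP; exact: measurable_funX.
have x20 (x : R) : (0 <= (x ^+ 2)%:E)%E by rewrite lee_fin sqr_ge0.
rewrite ge0_integral_normal_prob//.
rewrite EFinM -(integral_expR_quadratic 0)//.
pose q (x : rT) : R := normal_peak 1 * expR (- (2^-1 / 2) * (x - 0) ^+ 2).
have mq : measurable_fun setT (fun x : rT => (q x)%:E).
  apply/measurable_EFinP; apply: measurable_funM => //.
  apply: measurableT_comp => //; apply: measurable_funM => //.
  by apply: measurable_funX; exact: measurable_funB.
have q0 x : (0 <= (q x)%:E)%E.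
  by rewrite lee_fin mulr_ge0 ?expR_ge0// normal_peak_ge0.
rewrite -ge0_integralZl//.
apply: ge0_le_integral => //.
- by move=> x _; rewrite mule_ge0// lee_fin normal_pdf_ge0.
- by apply: emeasurable_funM => //; apply/measurable_EFinP;
    exact: measurable_normal_pdf.
- by apply: emeasurable_funM => //; exact: mq.
- move=> x _; rewrite -!EFinM lee_fin std_normal_pdfE mulrCA [leRHS]mulrCA.
  rewrite ler_wpM2l ?normal_peak_ge0//.
  have -> : - (2^-1 / 2) * (x - 0) ^+ 2 = x ^+ 2 / 4 - x ^+ 2 / 2 by field.
  rewrite expRD mulrA ler_wpM2r ?expR_ge0//.
  have := expR_ge1Dx (x ^+ 2 / 4); lra.
- by move=> x _; exact: q0.
Qed.

Lemma std_gaussian_coord n (i : 'I_n) (f : rT -> \bar R) :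
  measurable_fun setT f -> (forall x, 0 <= f x)%E ->
  (\int[G n]_z f (z i ord0) = \int[N01]_x f x)%E.
Proof.
move=> mf f0; elim: n i => [[]//|n IHn] i.
have mh : measurable_fun setT (fun z : 'cV[R]_n.+1 => f (z i ord0)).
  exact: (measurableT_comp mf (measurable_coord i)).
apply: (etrans (std_gaussian_integralS mh (fun z => f0 _))).
case: (unliftP ord0 i) => [j ->|->].
  rewrite -[RHS](IHn j) -[RHS](integral_cst_probability N01).
  apply: eq_integral => x _; apply: eq_integral => z _.
  by rewrite mxE liftK.
apply: eq_integral => x _.
rewrite -[RHS](integral_cst_probability (G n)).
by apply: eq_integral => z _; rewrite mxE unlift_none.
Qed.

Lemma prod_measurable n (g : 'I_n -> rT -> R) :
  (forall i, measurable_fun setT (g i)) ->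
  measurable_fun setT (fun z : 'cV[R]_n => \prod_i g i (z i ord0)).
Proof.
move=> mg; apply: measurable_prod => i _.
exact: (measurableT_comp (mg i) (measurable_coord i)).
Qed.

Lemma prod_col_cons n (g : 'I_n.+1 -> rT -> R) x (z : 'cV[R]_n) :
  \prod_i g i (col_cons (x, z) i ord0) =
  g ord0 x * \prod_i g (lift ord0 i) (z i ord0).
Proof.
rewrite big_ord_recl mxE unlift_none; congr (_ * _).
by apply: eq_bigr => i _; rewrite mxE liftK.
Qed.

Lemma std_gaussian_affine n (m s : 'I_n -> R) (h : 'cV[R]_n -> \bar R) :
  (forall i, 0 < s i) -> measurable_fun setT h -> (forall z, 0 <= h z)%E ->
  (\int[G n]_z h (\col_i (m i + s i * z i ord0))%R =
   \int[G n]_z (h z * (\prod_i normal_ratio (m i) (s i) (z i ord0))%:E))%E.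
Proof.
elim: n m s h => [|n IHn] m s h s0 mh h0.
  apply: eq_integral => z _; rewrite big_ord0 mule1.
  by congr h; rewrite [LHS]flatmx0 [RHS]flatmx0.
have mprod k (m' s' : 'I_k -> R) : measurable_fun setT
    (fun z : 'cV[R]_k => (\prod_i normal_ratio (m' i) (s' i) (z i ord0))%:E).
  apply/measurable_EFinP; apply: (prod_measurable
    (g := fun i => normal_ratio (m' i) (s' i))) => i.
  exact: measurable_normal_ratio.
have prod0 k (m' s' : 'I_k -> R) : (forall i, 0 < s' i) -> forall z : 'cV[R]_k,
    (0 <= (\prod_i normal_ratio (m' i) (s' i) (z i ord0))%:E)%E.
  by move=> s'0 z; rewrite lee_fin prodr_ge0// => i _; exact: normal_ratio_ge0.
have ma k (m' s' : 'I_k -> R) : measurable_fun setT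
    (fun z : 'cV[R]_k => \col_i (m' i + s' i * z i ord0)).
  apply: measurable_fun_coordP => i; under eq_fun do rewrite mxE.
  apply: measurable_funD => //; apply: measurable_funM => //.
  exact: measurable_coord.
have mh1 : measurable_fun setT (fun z : 'cV[R]_n.+1 =>
    h (\col_i (m i + s i * z i ord0))) by exact: (measurableT_comp mh (ma _ m s)).
apply: (etrans (std_gaussian_integralS mh1 (fun z => h0 _))).
have mh2 : measurable_fun setT (fun z : 'cV[R]_n.+1 =>
    (h z * (\prod_i normal_ratio (m i) (s i) (z i ord0))%:E)%E).
  exact: (emeasurable_funM mh (mprod _ m s)).
apply: (etrans _ (esym (std_gaussian_integralS mh2 _))); last first.
  by move=> z; rewrite mule_ge0// prod0.
pose m' := m \o lift ord0; pose s' := s \o lift ord0.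
pose g (x : rT) : \bar R := (\int[G n]_z (h (col_cons (x, z)) *
    (\prod_i normal_ratio (m' i) (s' i) (z i ord0))%:E))%E.
have mgh : measurable_fun setT (fun p : rT * 'cV[R]_n => (h (col_cons p) *
    (\prod_i normal_ratio (m' i) (s' i) (p.2 i ord0))%:E)%E).
  apply: emeasurable_funM; first exact: (measurableT_comp mh (@measurable_col_cons R n)).
  exact: (measurableT_comp (mprod _ m' s') measurable_snd).
have gh0 (p : rT * 'cV[R]_n) : (0 <= h (col_cons p) *
    (\prod_i normal_ratio (m' i) (s' i) (p.2 i ord0))%:E)%E.
  by rewrite mule_ge0// prod0// => i; exact: s0.
have mg : measurable_fun setT g.
  exact: (measurable_fun_fubini_tonelli_F (m2 := G n) _ mgh gh0).
have g0 x : (0 <= g x)%E by apply: integral_ge0 => z _; exact: (gh0 (x, z)).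
transitivity (\int[N01]_x g (m ord0 + s ord0 * x)%R)%E.
  apply: eq_integral => x _.
  rewrite /g -(IHn m' s' (fun z => h (col_cons (_, z))))//; last 2 first.
  - by move=> i; exact: s0.
  - by apply: (measurableT_comp mh); exact: measurable_col_cons2.
  apply: eq_integral => z _; congr h; apply/colP => i; rewrite !mxE.
  by case: (unliftP ord0 i) => [j|] -> /=; rewrite ?mxE.
rewrite (integral_normal_affine _ (s0 ord0) mg g0); apply: eq_integral => x _.
rewrite muleC -ge0_integralZl//; last 2 first.
- by apply: (measurableT_comp mgh); exact: measurable_fun_pair.
- by rewrite lee_fin normal_ratio_ge0.
apply: eq_integral => z _.
rewrite (prod_col_cons (fun i => normal_ratio (m i) (s i))) EFinM.
by rewrite muleCA.
Qed.

(** By independence the expectations multiply, so the exponents add up: this is how the dimension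
    enters the bound linearly. *)
Lemma std_gaussian_prod_le n (g : 'I_n -> rT -> R) (e : 'I_n -> R) :
  (forall i, measurable_fun setT (g i)) -> (forall i x, 0 <= g i x) ->
  (forall i, \int[N01]_x (g i x)%:E <= (expR (e i))%:E)%E ->
  (\int[G n]_z (\prod_i g i (z i ord0))%:E <= (expR (\sum_i e i))%:E)%E.
Proof.
elim: n g e => [|n IHn] g e mg g0 ge.
  under eq_integral do rewrite big_ord0.
  by rewrite big_ord0 expR0 integral_cst_probability.
have mp : measurable_fun setT (fun z : 'cV[R]_n.+1 => (\prod_i g i (z i ord0))%:E).
  by apply/measurable_EFinP; exact: prod_measurable.
have p0 (z : 'cV[R]_n.+1) : (0 <= (\prod_i g i (z i ord0))%:E)%E.
  by rewrite lee_fin prodr_ge0.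
apply: (@le_trans _ _ (\int[N01]_x \int[G n]_z
    (\prod_i g i (col_cons (x, z) i ord0))%:E)%E).
  by rewrite (std_gaussian_integralS mp p0).
set E := (expR (\sum_(i < n) e (lift ord0 i)))%:E.
have IH : (\int[G n]_z (\prod_i g (lift ord0 i) (z i ord0))%:E <= E)%E.
  by apply: (IHn (fun i => g (lift ord0 i)) (fun i => e (lift ord0 i))) => i;
    [exact: mg|exact: g0|exact: ge].
have mp' : measurable_fun setT
    (fun z : 'cV[R]_n => (\prod_i g (lift ord0 i) (z i ord0))%:E).
  by apply/measurable_EFinP; apply: (prod_measurable (g := fun i => g (lift ord0 i))).
have p'0 (z : 'cV[R]_n) : (0 <= (\prod_i g (lift ord0 i) (z i ord0))%:E)%E.
  by rewrite lee_fin prodr_ge0.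
set I := (\int[G n]_z (\prod_i g (lift ord0 i) (z i ord0))%:E)%E in IH.
have I0 : (0 <= I)%E by exact: integral_ge0.
have -> : (\int[N01]_x \int[G n]_z (\prod_i g i (col_cons (x, z) i ord0))%:E =
    (\int[N01]_x (g ord0 x)%:E) * I)%E.
  rewrite -ge0_integralZr//; last 2 first.
  - exact/measurable_EFinP.
  - by move=> x _; rewrite lee_fin.
  apply: eq_integral => x _; rewrite /I -ge0_integralZl//; last by rewrite lee_fin.
  by apply: eq_integral => z _; rewrite prod_col_cons EFinM.
rewrite big_ord_recl expRD EFinM lee_pmul// integral_ge0// => x _.
by rewrite lee_fin.
Qed.

End gaussian_density.

(** * The posterior distribution *)

Section rational_boxes.
Context {R : realType}.
Variable n : nat.

(* This pi-system is countable, so that an identity that holds almost surely for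
   each box holds outside a single null set for all events. *)
Definition rat_box (q : {ffun 'I_n -> option rat}) : set 'cV[R]_n :=
  [set x | forall i r, q i = Some r -> x i ord0 <= ratr r].

Lemma measurable_rat_box q : measurable (rat_box q).
Proof.
have -> : rat_box q = \bigcap_(i in [set: 'I_n])
    (fun x : 'cV[R]_n => x i ord0) @^-1`
      (if q i is Some r then `]-oo, ratr r]%classic else setT).
  apply/seteqP; split => x /= xq i.
    by move=> _; case qi: (q i) => [r|]//=; rewrite in_itv/=; exact: xq qi.
  by move=> r qi; have := xq i Logic.I; rewrite /= qi/= in_itv.
apply: fin_bigcap_measurable => // i _; rewrite -[X in measurable X]setTI.
by apply: measurable_coord => //; case: (q i).
Qed.

Lemma setI_closed_rat_box : setI_closed (range rat_box).
Proof.
move=> _ _ [q _ <-] [q' _ <-].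
exists [ffun i => match q i, q' i with
  | Some r, Some r' => Some (Num.min r r')
  | Some r, None => Some r
  | None, o => o end] => //.
apply/seteqP; split => x /=.
  move=> xq; split=> i r qi; have := xq i; rewrite ffunE qi.
    case: (q' i) => [r'|] /(_ _ erefl)//; rewrite -[ratr r]/(ratr r).
    by move=> /le_trans; apply; rewrite ler_rat ge_min lexx.
  case: (q i) => [r'|] /(_ _ erefl)//.
  by move=> /le_trans; apply; rewrite ler_rat ge_min lexx orbT.
move=> [xq xq'] i r; rewrite ffunE.
case qi: (q i) => [r1|]; case q'i: (q' i) => [r2|]// [<-].
- by rewrite /Num.min; case: ifP => _; [exact: xq qi|exact: xq' q'i].
- exact: xq qi.
- exact: xq' q'i.
Qed.

(** An open ray in coordinate i is the union, over rationals r below its end point, of the boxes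
    that constrain only coordinate i by r. *)
Lemma measurable_rat_boxE : @measurable _ 'cV[R]_n = <<s range rat_box >>.
Proof.
apply/seteqP; split; last first.
  apply: smallest_sub; first exact: sigma_algebra_measurable.
  by move=> _ [q _ <-]; exact: measurable_rat_box.
have mcoord i : measurable_fun [set: g_sigma_algebraType (range rat_box)]
    (fun x : 'cV[R]_n => x i ord0 : measurableTypeR R).
  apply: (measurability (@RGenInftyO.G R)); first exact: RGenInftyO.measurableE.
  move=> _ [_ [x ->] <-]; rewrite setTI.
  have -> : (fun z : 'cV[R]_n => z i ord0) @^-1` `]-oo, x[ =
      \bigcup_r (if ratr r < x then
        rat_box [ffun j => if j == i then Some r else None] else set0).
    apply/seteqP; split => z /=; rewrite in_itv/=.
      move=> zx; have [r] := rat_in_itvoo zx; rewrite in_itv/= => /andP[zr rx].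
      exists r => //; rewrite rx => j r'; rewrite ffunE; case: eqP => // -> [<-].
      exact: ltW.
    move=> [r _]; case: ifP => // rx /(_ i r); rewrite ffunE eqxx => /(_ erefl).
    by move=> /le_lt_trans; apply.
  apply: bigcupT_measurable_rat => r; case: ifP => _; last exact: measurable0.
  by apply: sub_sigma_algebra; exists [ffun j => if j == i then Some r else None].
apply: smallest_sub; first exact: smallest_sigma_algebra.
rewrite -bigcup_seq; apply: bigcup_sub => i _ A [B mB <-].
exact: (mcoord i measurableT B mB).
Qed.

Lemma eq_measure_rat_box (m1 m2 : {measure set 'cV[R]_n -> \bar R}) :
  (m1 setT < +oo)%E -> (forall q, m1 (rat_box q) = m2 (rat_box q)) ->
  forall A, measurable A -> m1 A = m2 A.
Proof.
move=> m1oo m12; have boxT : rat_box [ffun=> None] = setT.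
  by apply/seteqP; split => // x _ i r; rewrite ffunE.
apply: (measure_unique (range rat_box) (fun=> setT)).
- exact: measurable_rat_boxE.
- exact: setI_closed_rat_box.
- by move=> _; exists [ffun=> None].
- by apply/seteqP; split => // x _; exists 0%N.
- by move=> _ [q _ <-].
- by [].
Qed.

End rational_boxes.

Lemma ae_eq_rat_box (R : realType) n d (T : measurableType d)
    (mu : {measure set T -> \bar R}) (f g : T -> {measure set 'cV[R]_n -> \bar R}) :
  (forall A, measurable A -> measurable_fun setT (f ^~ A)) ->
  (forall A, measurable A -> measurable_fun setT (g ^~ A)) ->
  (forall y, f y setT < +oo)%E ->
  (forall A, measurable A -> ae_eq mu setT (f ^~ A) (g ^~ A)) ->
  exists2 N : set T, measurable N /\ mu N = 0%E &
    forall y, ~ N y -> forall A, measurable A -> f y A = g y A.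
Proof.
move=> mf mg foo fg; pose bad q := [set y | f y (rat_box q) != g y (rat_box q)].
have mbad q : measurable (bad q).
  rewrite -[bad q]setTI; apply: measurable_neqe => //.
    by apply: mf; exact: measurable_rat_box.
  by apply: mg; exact: measurable_rat_box.
have nbad q : mu.-negligible (bad q).
  have := fg _ (measurable_rat_box q); apply: negligibleS => y /= /eqP + fgy.
  by apply; exact: fgy.
pose F k := if unpickle k is Some q then bad q else set0.
exists (\bigcup_k F k).
  have mF k : measurable (F k).
    by rewrite /F; case: unpickle => [q|]; [exact: mbad|exact: measurable0].
  split; first exact: bigcupT_measurable.
  apply: measure_negligible; first exact: bigcupT_measurable.
  apply: negligible_bigcup => k; rewrite /F; case: unpickle => [q|]; first exact: nbad.
  exact: negligible_set0.
move=> y Ny; apply: eq_measure_rat_box; first exact: foo.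
move=> q; apply/eqP; apply: contrapT => /negP fgq; apply: Ny.
by exists (pickle q) => //; rewrite /F pickleK.
Qed.

Lemma integral_mkcond_indic d (T : measurableType d) (R : realType)
    (mu : {measure set T -> \bar R}) (D : set T) (f : T -> \bar R) :
  (\int[mu]_(x in D) f x = \int[mu]_x ((\1_D x)%:E * f x))%E.
Proof.
rewrite integral_mkcond; apply: eq_integral => x _; rewrite patchE indicE.
by case: ifP => _; rewrite ?mul1e ?mul0e.
Qed.

Section gaussian_posterior.
Context {R : realType}.
Local Notation G n := (@std_gaussian R n).

Lemma integral_gaussian n (m : 'cV[R]_n) c P (h : 'cV[R]_n -> \bar R) :
  0 <= c -> orth_proj P -> measurable_fun setT h -> (forall y, 0 <= h y)%E ->
  (\int[gaussian m (c ^+ 2 *: P)]_y h y = \int[G n]_z h (m + c *: (P *m z))%R)%E.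
Proof.
move=> c0 pP mh h0; rewrite ge0_integral_distribution//.
apply: eq_integral => z _; rewrite /= /affine sqrtmx_orth_proj//.
by rewrite -scalemxAl.
Qed.

Lemma gaussian_proj n (m : 'cV[R]_n) c P A :
  0 <= c -> orth_proj P -> measurable A ->
  (gaussian m (c ^+ 2 *: P) A = \int[G n]_z (\1_A (m + c *: (P *m z)))%:E)%E.
Proof.
move=> c0 pP mA; rewrite -(integral_gaussian _ (h := fun y => (\1_A y)%:E))//.
  by rewrite integral_indic// setIT.
by apply/measurable_EFinP; exact: measurable_indic.
Qed.

Lemma gaussian_scalar n (m : 'cV[R]_n) c A : 0 <= c -> measurable A ->
  (gaussian m (c ^+ 2)%:M A = \int[G n]_z (\1_A (m + c *: z))%:E)%E.
Proof.
move=> c0 mA; rewrite -scalemx1 gaussian_proj//; last exact: orth_proj1.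
by apply: eq_integral => z _; rewrite mul1mx.
Qed.

(** The translated law has a density with respect to [std_gaussian]: the product of the coordinate
    ratios with s = 1. *)
Lemma gaussian_shift_null n (d : 'cV[R]_n) U : measurable U -> G n U = 0%E ->
  (\int[G n]_z (\1_U (z + d)%R)%:E = 0)%E.
Proof.
move=> mU U0.
have mI : measurable_fun setT (fun z : 'cV[R]_n => (\1_U z)%:E : \bar R).
  by apply/measurable_EFinP; exact: measurable_indic.
have I0 z : (0 <= (\1_U z)%:E :> \bar R)%E by rewrite lee_fin.
have := @std_gaussian_affine R n (fun i => d i ord0) (fun=> 1) _ (fun=> ltr01) mI I0.
have -> : (\int[G n]_z (\1_U (\col_i (d i ord0 + 1 * z i ord0)%R))%:E =
    \int[G n]_z (\1_U (z + d)%R)%:E)%E.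
  apply: eq_integral => z _; congr (\1_U _)%:E.
  by apply/colP => i; rewrite !mxE mul1r addrC.
move=> ->; rewrite -integral_mkcond_indic null_set_integral//.
apply: measurable_funTS; apply/measurable_EFinP; apply: (prod_measurable
    (g := fun i => normal_ratio (d i ord0) 1)) => i.
exact: measurable_normal_ratio.
Qed.

(** Nonsingular covariance makes all these laws equivalent; this brings null sets of the Bayesian
    marginal to the true law, whatever its mean. *)
Lemma gaussian_scalar_null n (m m' : 'cV[R]_n) c A : 0 < c -> measurable A ->
  gaussian m (c ^+ 2)%:M A = 0%E -> gaussian m' (c ^+ 2)%:M A = 0%E.
Proof.
move=> c0 mA; rewrite !gaussian_scalar ?ltW//.
pose U := (fun z : 'cV[R]_n => m + c *: z) @^-1` A.
have mU : measurable U.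
  rewrite -[U]setTI; apply: (_ : measurable_fun setT _) => //.
  by apply: measurable_vecD => //; exact: measurable_vecZ.
have -> : (\int[G n]_z (\1_A (m + c *: z)%R)%:E = G n (U `&` setT))%E.
  by rewrite -integral_indic.
rewrite setIT => /(gaussian_shift_null (c^-1 *: (m' - m)) mU) <-.
apply: eq_integral => z _; rewrite -[\1_U _]/(\1_A (m + c *: (z + _))).
congr (\1_A _)%:E; rewrite scalerDr scalerA divff ?gt_eqF// scale1r.
by rewrite [RHS]addrC -addrA subrK addrC.
Qed.

Section joint_law.
Variables (n k : nat) (M P : 'M[R]_n) (sigma tau : R).
Hypotheses (oM : gaussian_orth M) (MP : M *m P *m M^T = pid_mx k).
Hypotheses (pP : orth_proj P) (sigma0 : 0 < sigma) (tau0 : 0 < tau).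
Variable Q : probability ('cV[R]_n * 'cV[R]_n)%type R.
Hypothesis Qprior : forall A, measurable A ->
  Q (fst @^-1` A) = gaussian 0 (tau ^+ 2 *: P) A.
Hypothesis Qmodel : is_cond_distr Q fst snd (gaussian_model (sigma ^+ 2)%:M).

Let r := Num.sqrt (sigma ^+ 2 + tau ^+ 2).

Let r2 : r ^+ 2 = sigma ^+ 2 + tau ^+ 2.
Proof. by rewrite sqr_sqrtr// addr_ge0 ?sqr_ge0. Qed.

Let r0 : 0 < r.
Proof. by rewrite sqrtr_gt0 addr_gt0// exprn_gt0. Qed.

Let a := tau ^+ 2 / (sigma ^+ 2 + tau ^+ 2).
Let b := tau * sigma / r.
(** [K] is the symmetric square root of sigma^2 I + tau^2 P, the marginal covariance of Y. *)
Let K : 'M[R]_n := r *: P + sigma *: (1%:M - P).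

Lemma joint_law_prior A B : measurable A -> measurable B ->
  (Q (fst @^-1` A `&` snd @^-1` B) = \int[G n]_u \int[G n]_v
    (\1_A (tau *: (P *m u)) * \1_B (tau *: (P *m u) + sigma *: v))%:E)%E.
Proof.
move=> mA mB; rewrite (Qmodel mA mB).
have mk : measurable_fun setT (gaussian_model (sigma ^+ 2)%:M ^~ B).
  exact: measurable_gaussian_model.
have mk1 : measurable_fun setT (fun f : 'cV[R]_n =>
    ((\1_A f)%:E * gaussian_model (sigma ^+ 2)%:M f B)%E).
  by apply: emeasurable_funM => //; apply/measurable_EFinP; exact: measurable_indic.
have k10 f : (0 <= (\1_A f)%:E * gaussian_model (sigma ^+ 2)%:M f B)%E.
  by rewrite mule_ge0// lee_fin.
transitivity (\int[pushforward Q fst]_(f in A)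
    gaussian_model (sigma ^+ 2)%:M f B)%E.
  rewrite ge0_integral_pushforward//; exact: measurable_funTS.
transitivity (\int[gaussian 0 (tau ^+ 2 *: P)]_(f in A)
    gaussian_model (sigma ^+ 2)%:M f B)%E.
  by apply: eq_measure_integral => X mX _; exact: Qprior.
rewrite integral_mkcond_indic integral_gaussian ?ltW//.
apply: eq_integral => u _; rewrite add0r.
transitivity ((\1_A (tau *: (P *m u)))%:E * \int[G n]_v
    (\1_B (tau *: (P *m u) + sigma *: v))%:E)%E.
  by congr (_ * _)%E; exact: gaussian_scalar (ltW sigma0) mB.
rewrite -ge0_integralZl//.
  apply/measurable_EFinP; apply: measurableT_comp; first exact: measurable_indic.
  by apply: measurable_vecD => //; exact: measurable_vecZ.
Qed.

(* With r^2 = sigma^2 + tau^2, rotate the pair (u, v) of joint_law_prior by the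
   angle of cosine sigma / r inside the range of P: then Y = K v depends only on
   the second variable, and F = a P Y + b P u. *)
Lemma joint_law_posterior A B : measurable A -> measurable B ->
  (Q (fst @^-1` A `&` snd @^-1` B) = \int[G n]_v
    ((\1_B (K *m v))%:E * gaussian (a *: (P *m (K *m v))) (b ^+ 2 *: P) A))%E.
Proof.
move=> mA mB; rewrite joint_law_prior//.
pose h (p : 'cV[R]_n * 'cV[R]_n) : \bar R :=
  (\1_A (tau *: (P *m p.1)) * \1_B (tau *: (P *m p.1) + sigma *: p.2))%:E.
have mP1 : measurable_fun setT (fun p : 'cV[R]_n * 'cV[R]_n => P *m p.1).
  exact: (measurableT_comp (measurable_mulmx P) measurable_fst).
have mh : measurable_fun setT h.
  apply/measurable_EFinP; apply: measurable_funM;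
    apply: measurableT_comp; try exact: measurable_indic.
    exact: measurable_vecZ.
  apply: measurable_vecD; first exact: measurable_vecZ.
  by apply: measurable_vecZ; exact: measurable_snd.
have h0 p : (0 <= h p)%E by rewrite lee_fin mulr_ge0.
have [sP P2] := pP.
have cs : (sigma / r) ^+ 2 + (tau / r) ^+ 2 = 1.
  by rewrite !expr_div_n -mulrDl -r2 divff// sqrf_eq0 gt_eqF.
have c1 : -1 < sigma / r.
  by rewrite (lt_le_trans (ltrN10 R))// divr_ge0// ltW.
apply: (etrans (esym (proj_rotation oM MP cs c1 mh h0))).
have KE v : K *m v = r *: (P *m v) + sigma *: (v - P *m v).
  by rewrite mulmxDl -!scalemxAl mulmxBl mul1mx.
have PK v : P *m (K *m v) = r *: (P *m v).
  rewrite KE mulmxDr -!scalemxAr mulmxBr (mulmxA P P) P2 subrr scaler0.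
  by rewrite addr0.
have rn0 : r != 0 by rewrite gt_eqF.
pose g (p : 'cV[R]_n * 'cV[R]_n) : \bar R :=
  ((\1_B (K *m p.2))%:E * (\1_A (a *: (P *m (K *m p.2)) + b *: (P *m p.1)))%:E)%E.
have mK : measurable_fun setT (fun p : 'cV[R]_n * 'cV[R]_n => K *m p.2).
  exact: (measurableT_comp (measurable_mulmx K) measurable_snd).
have mg : measurable_fun setT g.
  apply: emeasurable_funM; apply/measurable_EFinP;
    apply: measurableT_comp; try exact: measurable_indic; first by exact: mK.
  apply: measurable_vecD; last exact: measurable_vecZ.
  by apply: measurable_vecZ; exact: (measurableT_comp (measurable_mulmx P) mK).
have g0 p : (0 <= g p)%E by rewrite mule_ge0// lee_fin.
transitivity (\int[G n]_u \int[G n]_v g (u, v))%E.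
  apply: eq_integral => u _; apply: eq_integral => v _; rewrite /h /g /=.
  set z1 := _ + _ + _ *: _; set z2 := _ + _ + (v - _).
  have Pz1 : P *m z1 = (sigma / r) *: (P *m u) + (tau / r) *: (P *m v).
    rewrite /z1 !mulmxDr -!scalemxAr mulmxN !(mulmxA P P) P2 subrr addr0.
    by [].
  have -> : tau *: (P *m z1) = a *: (P *m (K *m v)) + b *: (P *m u).
    rewrite PK Pz1 scalerDr !scalerA addrC /a /b -r2; congr (_ *: _ + _ *: _).
      by field.
    by field.
  have -> : a *: (P *m (K *m v)) + b *: (P *m u) + sigma *: z2 = K *m v.
    rewrite PK KE /z2 /a /b -r2; apply/colP => i; rewrite !mxE.
    set x := \sum_j P i j * u j ord0; set y := \sum_j P i j * v j ord0.
    (* [field] treats [r] as a free variable, so the relation r^2 = sigma^2 + tau^2 is fed in by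
       rewriting the right-hand side. *)
    have rE : r = (sigma ^+ 2 + tau ^+ 2) / r by rewrite -r2 expr2 mulfK.
    rewrite [in RHS]rE; field.
    by [].
  by rewrite mulrC EFinM.
apply: (etrans (fubini_tonelli (m1 := G n) (m2 := G n) g mg g0)).
apply: eq_integral => v _.
rewrite gaussian_proj//; last by rewrite /b divr_ge0 ?mulr_ge0// ltW.
rewrite -ge0_integralZl//.
  apply/measurable_EFinP; apply: measurableT_comp; first exact: measurable_indic.
  apply: measurable_vecD => //; apply: measurable_vecZ; exact: measurable_mulmx.
Qed.

(** Both kernels reproduce [Q] on rectangles, so for each event they agree almost everywhere under
    the marginal [LY], and then for all events at once by rational boxes. The null set is chosen
    uniformly in the true mean [m]. *)
Lemma posterior_law (post : R.-pker 'cV[R]_n ~> 'cV[R]_n) :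
  is_cond_distr Q snd fst post ->
  exists2 N : set 'cV[R]_n, measurable N /\
      forall m, gaussian m (sigma ^+ 2)%:M N = 0%E &
    forall y, ~ N y -> forall A, measurable A ->
      post y A = gaussian ((tau ^+ 2 / (sigma ^+ 2 + tau ^+ 2)) *: (P *m y))
        ((tau * sigma / Num.sqrt (sigma ^+ 2 + tau ^+ 2)) ^+ 2 *: P) A.
Proof.
move=> Qpost; pose LY : probability 'cV[R]_n R := distribution (G n) (affine 0 K).
pose kap (y : 'cV[R]_n) : {measure set 'cV[R]_n -> \bar R} :=
  gaussian_model (b ^+ 2 *: P) (a *: (P *m y)).
have mkap A : measurable A -> measurable_fun setT (kap ^~ A).
  move=> mA; apply: (measurableT_comp (measurable_gaussian_model (b ^+ 2 *: P) mA)).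
  by apply: measurable_vecZ; exact: measurable_mulmx.
have mpost A : measurable A -> measurable_fun setT (post ^~ A).
  by move=> mA; exact: measurable_kernel.
have mI B : measurable B -> measurable_fun setT
    (fun y : 'cV[R]_n => (\1_B y)%:E : \bar R).
  by move=> mB; apply/measurable_EFinP; exact: measurable_indic.
have LYint B (h : 'cV[R]_n -> \bar R) : measurable B -> measurable_fun setT h ->
    (forall y, 0 <= h y)%E -> (\int[LY]_(y in B) h y =
    \int[G n]_v ((\1_B (K *m v))%:E * h (K *m v)))%E.
  move=> mB mh h0; rewrite integral_mkcond_indic ge0_integral_distribution.
  - by apply: eq_integral => v _; rewrite /= /affine add0r.
  - by apply: emeasurable_funM => //; exact: mI.
  - by move=> y; rewrite mule_ge0// lee_fin.
have LYE B : measurable B -> LY B = Q (snd @^-1` B).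
  move=> mB; have := joint_law_posterior measurableT mB.
  rewrite preimage_setT setTI => ->.
  have -> : LY B = LY (B `&` setT) by rewrite setIT.
  rewrite -(integral_indic LY measurableT mB) LYint//; last exact: mI.
  apply: eq_integral => v _; rewrite indicT mul1e.
  by rewrite [X in (_ * X)%E]probability_setT mule1.
have fg A : measurable A -> ae_eq LY setT (post ^~ A) (kap ^~ A).
  move=> mA; apply: integral_ae_eq => //; last 2 first.
  - exact: mkap.
  - move=> E _ mE; rewrite [RHS](LYint E _ mE (mkap A mA))//.
    rewrite -(joint_law_posterior mA mE) setIC (Qpost _ _ mE mA).
    transitivity (\int[pushforward Q snd]_(y in E) post y A)%E.
      by apply: eq_measure_integral => X mX _; exact: LYE.
    rewrite ge0_integral_pushforward//; apply: measurable_funTS; exact: mpost.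
  apply/integrableP; split; first exact: mpost.
  apply: (@le_lt_trans _ _ (\int[LY]_y 1)%E).
    apply: ge0_le_integral => //.
    - by apply: measurableT_comp => //; exact: mpost.
    - move=> y _; rewrite gee0_abs// -(@prob_kernel _ _ _ _ _ post y).
      by apply: le_measure => //; rewrite inE.
  by rewrite integral_cst_probability ltry.
have poo y : (post y setT < +oo)%E by rewrite prob_kernel ltry.
have [N [mN LYN] Nfg] := ae_eq_rat_box mpost mkap poo fg.
exists N => //; split => // m.
(* [LY] is the mixture over u of the laws N(tau P u, sigma^2 I). Since the mixture does not charge
   [N], some component does not either, and by equivalence no N(m, sigma^2 I) does. *)
pose I u := gaussian (tau *: (P *m u)) (sigma ^+ 2)%:M N.
have mIu : measurable_fun setT I.
  apply: (measurableT_comp (measurable_gaussian_model (sigma ^+ 2)%:M mN)).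
  by apply: measurable_vecZ; exact: measurable_mulmx.
have : (\int[G n]_u I u = 0)%E.
  have <- : Q (snd @^-1` N) = 0%E by rewrite -LYE.
  rewrite -[snd @^-1` N]setTI -(preimage_setT fst) joint_law_prior//.
  apply: eq_integral => u _; rewrite /I gaussian_scalar ?ltW//.
  by apply: eq_integral => v _; rewrite indicT mul1r.
have -> : (\int[G n]_u I u = \int[G n]_u `|I u|)%E.
  by apply: eq_integral => u _; rewrite gee0_abs.
move=> /(ae_eq_integral_abs _ measurableT mIu) I0.
have [u Iu] : exists u, I u = 0%E.
  apply: contrapT => nI.
  have /(measure_negligible measurableT) : (G n).-negligible setT.
    by apply: negligibleS I0 => u _ /= Iu; apply: nI; exists u; exact: Iu.
  by rewrite [LHS]probability_setT => /eqP; rewrite onee_eq0.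
exact: gaussian_scalar_null Iu.
Qed.

End joint_law.
End gaussian_posterior.

(** * Total variation *)

(* AM-GM: |rho - 1| <= t / 2 + (rho - 1)^2 / (2 t). *)
Lemma density_event_le d (T : measurableType d) (R : realType)
    (mu : probability T R) (rho : T -> R) (q t : R) (B : set T) :
  measurable_fun setT rho -> (forall x, 0 <= rho x) -> 0 < t ->
  (\int[mu]_x (rho x)%:E = 1)%E ->
  (\int[mu]_x (rho x ^+ 2)%:E <= (1 + q)%:E)%E -> measurable B ->
  (`| \int[mu]_x ((\1_B x)%:E * (rho x)%:E) - mu B | <=
    (t / 2 + q / (2 * t))%:E)%E.
Proof.
move=> mrho rho0 t0 rho1 rho2 mB.
have mI : measurable_fun setT (fun x : T => (\1_B x)%:E : \bar R).
  by apply/measurable_EFinP; exact: measurable_indic.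
have mr : measurable_fun setT (fun x => (rho x)%:E) by exact/measurable_EFinP.
have mr2 : measurable_fun setT (fun x => (rho x ^+ 2)%:E).
  by apply/measurable_EFinP; exact: measurable_funX.
set X := (\int[mu]_x ((\1_B x)%:E * (rho x)%:E))%E.
have mIr : measurable_fun setT (fun x => (\1_B x)%:E * (rho x)%:E)%E.
  exact: emeasurable_funM.
have Ir0 x : (0 <= (\1_B x)%:E * (rho x)%:E)%E by rewrite mule_ge0// lee_fin.
have X0 : (0 <= X)%E by exact: integral_ge0.
have X1 : (X <= 1)%E.
  rewrite -rho1; apply: ge0_le_integral => // x _.
  by rewrite -EFinM lee_fin ler_piMl// indicE; case: (_ \in _).
have XE : X = (fine X)%:E.
  by rewrite fineK// ge0_fin_numE// (le_lt_trans X1)// ltry.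
have mBE : mu B = (fine (mu B))%:E by rewrite fineK// fin_num_measure.
have iB : (\int[mu]_x (\1_B x)%:E = mu B)%E by rewrite integral_indic// setIT.
have I2 : (\int[mu]_x (rho x ^+ 2)%:E)%E = (fine (\int[mu]_x (rho x ^+ 2)%:E)%E)%:E.
  rewrite fineK// ge0_fin_numE ?integral_ge0// => [|x _]; last by rewrite lee_fin sqr_ge0.
  by rewrite (le_lt_trans rho2)// ltry.
set J := fine (\int[mu]_x (rho x ^+ 2)%:E) in I2.
have Jq : J <= 1 + q by rewrite -lee_fin -I2.
have t2 : 0 < (2 * t)^-1 by rewrite invr_gt0 mulr_gt0.
have iquad : (\int[mu]_x ((t / 2 + (2 * t)^-1)%:E + (2 * t)^-1%:E * (rho x ^+ 2)%:E)
    = (t / 2 + (2 * t)^-1 + (2 * t)^-1 * J)%:E)%E.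
  rewrite ge0_integralD//.
  - rewrite integral_cst_probability ge0_integralZl//.
    + by rewrite I2.
    + by move=> x _; rewrite lee_fin sqr_ge0.
    + by rewrite lee_fin ltW.
  - by move=> x _; rewrite lee_fin; nra.
  - by move=> x _; rewrite -EFinM lee_fin mulr_ge0 ?sqr_ge0// ltW.
  - exact: measurable_funeM.
(* Here e stands for the indicator of [B]. The cross term -r / t of (r - 1)^2 / (2 t) is moved to
   the left, so that only nonnegative functions get integrated. *)
have amgm (r e : R) : e = 0 \/ e = 1 -> 0 <= r -> e * r + t^-1 * r <=
    e + (t / 2 + (2 * t)^-1 + (2 * t)^-1 * r ^+ 2) /\
    e + t^-1 * r <= e * r + (t / 2 + (2 * t)^-1 + (2 * t)^-1 * r ^+ 2).
  have tE : (2 * t)^-1 = t^-1 / 2 by rewrite invfM mulrC.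
  have sq x : x <= t / 2 + t^-1 / 2 * x ^+ 2.
    rewrite -subr_ge0; have -> : t / 2 + t^-1 / 2 * x ^+ 2 - x = t^-1 / 2 * (x - t) ^+ 2.
      by field; rewrite gt_eqF.
    by rewrite mulr_ge0 ?sqr_ge0// divr_ge0// invr_ge0 ltW.
  by rewrite tE; have := sq (r - 1); have := sq (1 - r); have := sq r;
    have := sq (- r); case=> [] s1 s2 s3 s4 [] -> _; split; lra.
have iL (f : T -> \bar R) : measurable_fun setT f -> (forall x, 0 <= f x)%E ->
    (\int[mu]_x (f x + t^-1%:E * (rho x)%:E) = \int[mu]_x f x + t^-1%:E)%E.
  move=> mf f0; have ti : (0 <= t^-1%:E)%E by rewrite lee_fin invr_ge0 ltW.
  rewrite ge0_integralD//.
  - rewrite ge0_integralZl//; last by move=> x _; rewrite lee_fin.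
    by rewrite rho1 mule1.
  - by move=> x _; rewrite mule_ge0// lee_fin.
  - exact: measurable_funeM.
have quad0 x : (0 <= (t / 2 + (2 * t)^-1)%:E + (2 * t)^-1%:E * (rho x ^+ 2)%:E)%E.
  by rewrite -EFinM -EFinD lee_fin addr_ge0// ?mulr_ge0 ?sqr_ge0// ltW//; lra.
have mquad : measurable_fun setT (fun x : T =>
    (t / 2 + (2 * t)^-1)%:E + (2 * t)^-1%:E * (rho x ^+ 2)%:E)%E.
  by apply: emeasurable_funD => //; exact: measurable_funeM.
have iR (f : T -> \bar R) : measurable_fun setT f -> (forall x, 0 <= f x)%E ->
    (\int[mu]_x (f x + ((t / 2 + (2 * t)^-1)%:E + (2 * t)^-1%:E * (rho x ^+ 2)%:E)) =
     \int[mu]_x f x + (t / 2 + (2 * t)^-1 + (2 * t)^-1 * J)%:E)%E.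
  by move=> mf f0; rewrite ge0_integralD// iquad.
have I0 x : (0 <= (\1_B x)%:E :> \bar R)%E by rewrite lee_fin.
have mtr : measurable_fun setT (fun x => t^-1%:E * (rho x)%:E)%E.
  exact: measurable_funeM.
have tr0 x : (0 <= t^-1%:E * (rho x)%:E)%E.
  by rewrite mule_ge0// lee_fin// invr_ge0 ltW.
have ind01 x : \1_B x = 0 :> R \/ \1_B x = 1 :> R.
  by rewrite indicE; case: (_ \in _); [right|left].
have le1 : (X + t^-1%:E <= mu B + (t / 2 + (2 * t)^-1 + (2 * t)^-1 * J)%:E)%E.
  rewrite -iL// -iB -iR//; apply: ge0_le_integral => //.
  - by move=> x _; rewrite adde_ge0.
  - exact: emeasurable_funD.
  - exact: emeasurable_funD.
  - move=> x _; rewrite -!EFinM -!EFinD lee_fin.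
    by have [] := amgm _ _ (ind01 x) (rho0 x).
have le2 : (mu B + t^-1%:E <= X + (t / 2 + (2 * t)^-1 + (2 * t)^-1 * J)%:E)%E.
  rewrite -iB -iL// -iR//; apply: ge0_le_integral => //.
  - by move=> x _; rewrite adde_ge0.
  - exact: emeasurable_funD.
  - exact: emeasurable_funD.
  - move=> x _; rewrite -!EFinM -!EFinD lee_fin.
    by have [] := amgm _ _ (ind01 x) (rho0 x).
move: le1 le2; rewrite XE mBE -!EFinD !lee_fin => le1 le2.
have JE : (2 * t)^-1 * J <= (2 * t)^-1 * (1 + q) by rewrite ler_pM2l.
have tE : t^-1 = 2 * (2 * t)^-1 by rewrite invfM mulrA mulfV ?mul1r// pnatr_eq0.
by rewrite ler_norml; apply/andP; split; lra.
Qed.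

(** From exp (-x) >= 1 - x one gets exp x <= 1 / (1 - x) <= 1 + 2 x on this range. *)
Lemma expR_sub1_le (R : realType) (x : R) : 0 <= x -> x <= 2^-1 ->
  expR x - 1 <= 2 * x.
Proof.
move=> x0 x2; have := expR_ge1Dx (- x); rewrite expRN => h.
have e0 := expR_gt0 x.
have : (1 - x) * expR x <= 1.
  by rewrite -ler_pdivlMr// div1r.
nra.
Qed.

Section tv_bound.
Context {R : realType}.
Local Notation G n := (@std_gaussian R n).

(* Here 1 - e stands for the shrinkage factor tau^2 / (sigma^2 + tau^2). Relative
   to N(P y, sigma^2 P) the other law has a product density, with k nontrivial
   factors, whose squared L^2 norm is at most exp of e^2 (k + |P y|^2 / sigma^2). *)
Lemma gaussian_proj_tv_le n k (M P : 'M[R]_n) (sigma b e t : R) (y : 'cV[R]_n) :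
  gaussian_orth M -> M *m P *m M^T = pid_mx k -> orth_proj P -> (k <= n)%N ->
  0 < sigma -> 0 < b -> b ^+ 2 = (1 - e) * sigma ^+ 2 ->
  0 <= e -> e ^+ 2 <= 2^-1 -> 0 < t -> t <= 1 ->
  forall A, measurable A ->
  (`| gaussian ((1 - e) *: (P *m y)) (b ^+ 2 *: P) A -
      gaussian (P *m y) (sigma ^+ 2 *: P) A | <=
    (t / 2 + 2 * (e ^+ 2 * (k%:R +
      \sum_(i < n | (i < k)%N) ((M *m y) i ord0) ^+ 2 / sigma ^+ 2)) / t)%:E)%E.
Proof.
move=> [iM MTM] MP pP kn sigma0 b0 b2 e0 e2 t0 t1 A mA.
set x := e ^+ 2 * _.
have x0 : 0 <= x.
  rewrite mulr_ge0 ?sqr_ge0// addr_ge0// sumr_ge0// => i _.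
  by rewrite divr_ge0// sqr_ge0.
have sigman0 : sigma != 0 by rewrite gt_eqF.
(* If x > 1/2, then 2 x / t > 1 because t <= 1, and a difference of probabilities never exceeds
   1. *)
have [x2|x2] := leP x 2^-1; last first.
  apply: (@le_trans _ _ 1%E).
    set p := gaussian _ _ A; set q := gaussian _ _ A.
    have p1 : (p <= 1)%E by exact: probability_le1.
    have q1 : (q <= 1)%E by exact: probability_le1.
    have p0 : (0 <= p)%E by exact: measure_ge0.
    have q0 : (0 <= q)%E by exact: measure_ge0.
    move: p q p1 q1 p0 q0 => [p| |] [q| |]//; rewrite !lee_fin => *.
    by rewrite ler_norml; apply/andP; split; lra.
  rewrite lee_fin ler_wpDl ?divr_ge0 ?(ltW t0)//.
  by rewrite ler_pdivlMr// mul1r; lra.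
set N := M^T; have iN : gaussian_invariant N by exact: gaussian_invariantV iM.
have MN : M *m N = 1%:M by exact: mulmx1C.
have PN : P *m N = N *m pid_mx k by rewrite -MP !mulmxA MTM mul1mx.
have [sP P2] := pP.
have [w wE] : exists w : 'cV[R]_n, w = M *m y by exists (M *m y).
have Py : P *m y = N *m (pid_mx k *m w).
  by rewrite wE mulmxA -PN -mulmxA (mulmxA N) MTM mul1mx.
(* Solves (1 - e) w_i + b z = w_i + sigma (m_i + s_i z) for i < k; beyond k, the values 0 and 1 give
   the constant ratio 1. *)
pose m (i : 'I_n) : R := if (i < k)%N then - (e * w i ord0 / sigma) else 0.
pose s (i : 'I_n) : R := if (i < k)%N then b / sigma else 1.
have s0 i : 0 < s i by rewrite /s; case: ifP => _ //; rewrite divr_gt0.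
have s2 : (b / sigma) ^+ 2 = 1 - e by rewrite expr_div_n b2 mulfK// sqrf_eq0.
pose rho (z : 'cV[R]_n) := \prod_i normal_ratio (m i) (s i) (z i ord0).
pose B := (fun z : 'cV[R]_n => P *m y + sigma *: (N *m (pid_mx k *m z))) @^-1` A.
have mB : measurable B.
  rewrite -[B]setTI; apply: (_ : measurable_fun setT _) => //.
  apply: measurable_vecD => //; apply: measurable_vecZ.
  by apply: (measurableT_comp (measurable_mulmx N)); exact: measurable_mulmx.
have mI C : measurable C -> measurable_fun setT
    (fun z : 'cV[R]_n => (\1_C z)%:E : \bar R).
  by move=> mC; apply/measurable_EFinP; exact: measurable_indic.
have I0 (C : set 'cV[R]_n) z : (0 <= (\1_C z)%:E :> \bar R)%E by rewrite lee_fin.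
have mIc C (q : 'cV[R]_n) c : measurable C -> measurable_fun setT
    (fun z : 'cV[R]_n => (\1_C (q + c *: (P *m z)))%:E : \bar R).
  move=> mC; apply: (measurableT_comp (mI C mC)); apply: measurable_vecD => //.
  by apply: measurable_vecZ; exact: measurable_mulmx.
have -> : gaussian (P *m y) (sigma ^+ 2 *: P) A = G n B.
  apply: (etrans (gaussian_proj _ (ltW sigma0) pP mA)).
  apply: (etrans (esym (iN _ (mIc A (P *m y) sigma mA) (fun=> I0 _ _)))).
  have -> : G n B = G n (B `&` setT) by rewrite setIT.
  rewrite -(integral_indic (G n) measurableT mB).
  by apply: eq_integral => z _; rewrite (mulmxA P) PN -mulmxA.
have -> : gaussian ((1 - e) *: (P *m y)) (b ^+ 2 *: P) A =
    (\int[G n]_z ((\1_B z)%:E * (rho z)%:E))%E.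
  apply: (etrans (gaussian_proj _ (ltW b0) pP mA)).
  apply: (etrans (esym (iN _ (mIc A ((1 - e) *: (P *m y)) b mA) (fun=> I0 _ _)))).
  apply: (etrans _ (std_gaussian_affine m s0 (mI B mB) (I0 B))).
  apply: eq_integral => z _; set zz := \col_i _.
  rewrite -[\1_B _]/(\1_A (P *m y + sigma *: (N *m (pid_mx k *m zz)))).
  congr (\1_A _)%:E; rewrite (mulmxA P) PN -mulmxA Py; set D := pid_mx k.
  transitivity (N *m ((1 - e) *: (D *m w) + b *: (D *m z))).
    by rewrite mulmxDr -!scalemxAr.
  transitivity (N *m (D *m w + sigma *: (D *m zz))); last first.
    by rewrite mulmxDr -!scalemxAr.
  congr (_ *m _); rewrite !pid_mx_col; apply/colP => i; rewrite !mxE /m /s.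
  case: ifP => _; rewrite ?mul0r; last by ring.
  by rewrite !mul1r; field.
have mrho : measurable_fun setT rho.
  apply: (prod_measurable (g := fun i => normal_ratio (m i) (s i))) => i.
  exact: measurable_normal_ratio.
have rho0 z : 0 <= rho z.
  by rewrite prodr_ge0// => i _; exact: normal_ratio_ge0.
have rho1 : (\int[G n]_z (rho z)%:E = 1)%E.
  have m1 : measurable_fun setT (fun _ : 'cV[R]_n => 1%E : \bar R) by [].
  have := std_gaussian_affine m s0 m1 (fun _ => lee01).
  rewrite integral_cst_probability => ->.
  by apply: eq_integral => z _; rewrite mul1e.
pose ex (i : 'I_n) : R := if (i < k)%N then e ^+ 2 + m i ^+ 2 else 0.
have sum_ex : \sum_i ex i = x.
  rewrite /ex -big_mkcond big_split/= -(big_ord_widen n (fun=> e ^+ 2) kn).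
  rewrite sumr_const card_ord.
  rewrite /x -wE mulrDr mulr_natr; congr (_ + _); rewrite mulr_sumr.
  apply: eq_bigr => i ik; rewrite /m ik sqrrN expr_div_n exprMn mulrA.
  by [].
have rho2 : (\int[G n]_z (rho z ^+ 2)%:E <= (1 + 2 * x)%:E)%E.
  apply: (@le_trans _ _ (expR x)%:E); last first.
    by rewrite lee_fin; have := expR_sub1_le x0 x2; lra.
  under eq_integral do rewrite -prodrXl.
  rewrite -sum_ex; apply: (std_gaussian_prod_le
    (g := fun i z => normal_ratio (m i) (s i) z ^+ 2)) => i.
  - by apply: measurable_funX; exact: measurable_normal_ratio.
  - by move=> z; exact: sqr_ge0.
  - rewrite /ex /s; case: ifP => ik.
      apply: integral_normal_ratio_sqr_le => //; first exact: divr_gt0.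
    rewrite /m ik expR0; under eq_integral do rewrite normal_ratio01 expr1n.
    by rewrite integral_cst_probability.
apply: (le_trans (density_event_le mrho rho0 t0 rho1 rho2 mB)).
(* The density argument yields x / t; the factor 2 in the statement comes from the case x > 1/2. *)
have -> : 2 * x / (2 * t) = x / t by field; rewrite gt_eqF.
by rewrite lee_fin lerD2l ler_pM2r ?invr_gt0//; lra.
Qed.

End tv_bound.

(** The integral of a nonnegative function is the supremum over the simple functions below it, which
    is monotone for arbitrary functions. *)
Lemma ge0_le_integral_nonmeasurable d (T : measurableType d) (R : realType)
    (mu : {measure set T -> \bar R}) (f g : T -> \bar R) :
  (forall x, 0 <= f x)%E -> (forall x, f x <= g x)%E ->
  (\int[mu]_x f x <= \int[mu]_x g x)%E.
Proof.
move=> f0 fg; have g0 x : (0 <= g x)%E by exact: le_trans (f0 x) (fg x).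
rewrite !ge0_integralTE//; apply: le_ereal_sup => _ [h hf <-].
by exists h => // x; exact: le_trans (hf x) (fg x).
Qed.

(* No measurability of f: tv_dist is a supremum over uncountably many events. *)
Lemma ge0_le_integral_ae d (T : measurableType d) (R : realType)
    (mu : {measure set T -> \bar R}) (f g : T -> \bar R) (N : set T) :
  (forall x, 0 <= f x)%E -> (forall x, 0 <= g x)%E -> measurable_fun setT g ->
  measurable N -> mu N = 0%E -> (forall x, ~ N x -> f x <= g x)%E ->
  (\int[mu]_x f x <= \int[mu]_x g x)%E.
Proof.
move=> f0 g0 mg mN N0 fg.
have mI : measurable_fun setT (fun x : T => (\1_N x)%:E : \bar R).
  by apply/measurable_EFinP; exact: measurable_indic.
have I0 x : (0 <= (\1_N x)%:E :> \bar R)%E by rewrite lee_fin.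
(* This majorant is infinite on [N], so it dominates [f] everywhere, and its integral is that of [g]
   because [N] is null. *)
apply: (@le_trans _ _ (\int[mu]_x (g x + +oo * (\1_N x)%:E))%E).
  apply: ge0_le_integral_nonmeasurable => // x.
  rewrite indicE; have [xN|xN] := boolP (x \in N).
    by rewrite mule1 addey ?leey// gt_eqF// (lt_le_trans _ (g0 x)).
  by rewrite mule0 adde0; apply: fg; rewrite notin_setE in xN.
rewrite ge0_integralD//.
- rewrite ge0_integralZl// ?leey// integral_indic// setIT N0 mule0.
  by rewrite adde0.
- exact: measurable_funeM.
Qed.

Lemma tv_dist_ge0 d (T : measurableType d) (R : realType)
    (Q Q' : {measure set T -> \bar R}) : (0 <= tv_dist Q Q')%E.
Proof.
apply: (@le_trans _ _ `|Q set0 - Q' set0|%E); first exact: abse_ge0.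
by apply: ereal_sup_ubound; exists set0.
Qed.

(** * Expectation under the true law and passage to the limit *)

Section expected_tv.
Context {R : realType}.
Local Notation G n := (@std_gaussian R n).

Lemma enorm_sqr n (x : 'cV[R]_n) : enorm x ^+ 2 = \sum_i x i ord0 ^+ 2.
Proof. by rewrite sqr_sqrtr// sumr_ge0// => i _; exact: sqr_ge0. Qed.

Lemma enorm_orth n (M : 'M[R]_n) x : M^T *m M = 1%:M -> enorm (M *m x) = enorm x.
Proof.
move=> MTM; congr (Num.sqrt _); rewrite -!mul_tr_col trmx_mul.
by rewrite mulmxA -(mulmxA _ M^T M) MTM mulmx1.
Qed.

(** The bound for fixed y is averaged over y = F0 + sigma z. By (u + sigma v)^2 <= 2 u^2 + 2 sigma^2
    v^2, its random sum is at most 2 |F0|^2 / sigma^2 plus twice a sum of k squared standard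
    normals, each of mean at most [C]; then e <= sigma^2 / tau^2. *)
Lemma expected_tv_le (C : R) n k (Phi : 'M[R]_(n, k)) (post : R.-pker 'cV[R]_n ~> 'cV[R]_n)
    (sigma tau t : R) (F0 : 'cV[R]_n) :
  (\int[normal_prob 0 1]_x (x ^+ 2)%:E <= C%:E)%E ->
  0 < sigma -> 0 < tau -> \rank Phi = k -> (k <= n)%N ->
  is_posterior (gaussian 0 (tau ^+ 2 *: hat_mx Phi))
    (gaussian_model (sigma ^+ 2)%:M) post ->
  sigma ^+ 2 / tau ^+ 2 <= 2^-1 -> 0 < t -> t <= 1 ->
  (\int[gaussian F0 (sigma ^+ 2)%:M]_y
     tv_dist (post y) (gaussian (hat_mx Phi *m y) (sigma ^+ 2 *: hat_mx Phi)) <=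
   (t / 2 + 2 / t * ((1 + 2 * C) * (k%:R * sigma ^+ 4 / tau ^+ 4) +
      2 * (enorm F0 * sigma / tau ^+ 2) ^+ 2))%:E)%E.
Proof.
move=> Cle sigma0 tau0 rk kn [Q [Qprior Qmodel Qpost]] st t0 t1.
have pP := hat_mx_orth_proj rk; have [M [oM MP]] := hat_mx_diag rk.
move: (hat_mx Phi) pP MP Qprior => P pP MP Qprior.
have [N [mN N0] Npost] := posterior_law oM MP pP sigma0 tau0 Qprior Qmodel Qpost.
have st0 : 0 < sigma ^+ 2 + tau ^+ 2 by rewrite addr_gt0// exprn_gt0.
pose e := sigma ^+ 2 / (sigma ^+ 2 + tau ^+ 2).
have e0 : 0 < e by rewrite divr_gt0// exprn_gt0.
have eE : tau ^+ 2 / (sigma ^+ 2 + tau ^+ 2) = 1 - e.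
  by rewrite /e; field; rewrite gt_eqF.
have est : e <= sigma ^+ 2 / tau ^+ 2.
  rewrite ler_pM2l ?exprn_gt0// lef_pV2 ?posrE ?exprn_gt0//.
  by rewrite lerDr sqr_ge0.
have e2 : e ^+ 2 <= 2^-1 by nra.
set b := tau * sigma / Num.sqrt (sigma ^+ 2 + tau ^+ 2) in Npost.
have b0 : 0 < b by rewrite divr_gt0 ?mulr_gt0 ?sqrtr_gt0.
have b2 : b ^+ 2 = (1 - e) * sigma ^+ 2.
  rewrite /b expr_div_n sqr_sqrtr ?(ltW st0)// exprMn -eE; field.
  by rewrite gt_eqF.
pose S (y : 'cV[R]_n) := \sum_(i < n | (i < k)%N) ((M *m y) i ord0) ^+ 2 / sigma ^+ 2.
pose g (y : 'cV[R]_n) : \bar R := (t / 2 + 2 * (e ^+ 2 * (k%:R + S y)) / t)%:E.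
have S0 y : 0 <= S y.
  by rewrite sumr_ge0// => i _; rewrite divr_ge0// sqr_ge0.
have g0 y : (0 <= g y)%E.
  rewrite lee_fin addr_ge0 ?divr_ge0 ?(ltW t0)//.
  by rewrite mulr_ge0// mulr_ge0 ?sqr_ge0// addr_ge0.
have mS : measurable_fun setT S.
  have -> : S = (fun y => \sum_(i <- index_enum 'I_n)
      (if (i < k)%N then ((M *m y) i ord0) ^+ 2 / sigma ^+ 2 else 0)).
    by apply/funext => y; rewrite /S big_mkcond.
  apply: measurable_sum => i; case: (i < k)%N => //.
  apply: measurable_funM => //; apply: measurable_funX.
  exact: (measurableT_comp (measurable_coord i) (measurable_mulmx M)).
have mg : measurable_fun setT g.
  apply/measurable_EFinP; apply: measurable_funD => //; apply: measurable_funM => //.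
  apply: measurable_funM => //; apply: measurable_funM => //.
  exact: measurable_funD.
apply: (@le_trans _ _ (\int[gaussian F0 (sigma ^+ 2)%:M]_y g y)%E).
  apply: (ge0_le_integral_ae _ g0 mg mN (N0 F0)) => [y|y Ny].
    exact: tv_dist_ge0.
  apply: ge_ereal_sup => _ [A mA <-]; rewrite (Npost y Ny A mA) eE.
  by apply: (gaussian_proj_tv_le y oM MP pP kn sigma0 b0 b2 (ltW e0) e2 t0 t1).
have [iM MTM] := oM; have MN : M *m M^T = 1%:M by exact: mulmx1C.
have iN : gaussian_invariant M^T by exact: gaussian_invariantV iM.
rewrite -scalemx1 (integral_gaussian _ (ltW sigma0) (orth_proj1 n) mg g0).
have mg1 : measurable_fun setT (fun z : 'cV[R]_n => g (F0 + sigma *: (1%:M *m z))).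
  apply: (measurableT_comp mg); apply: measurable_vecD => //.
  by apply: measurable_vecZ; exact: measurable_mulmx.
(* Replacing z by M^T z turns the coordinates of M y into those of M F0 + sigma z, which involve the
   coordinates of z one at a time. *)
rewrite -(iN _ mg1 (fun z => g0 _)).
pose c := 2 / t * e ^+ 2.
have c0 : 0 <= c by rewrite mulr_ge0 ?sqr_ge0// divr_ge0// ltW.
pose q (i : 'I_n) (z : 'cV[R]_n) : \bar R := (if (i < k)%N then z i ord0 ^+ 2 else 0)%:E.
have mq i : measurable_fun setT (q i).
  apply/measurable_EFinP; case: (i < k)%N => //; apply: measurable_funX.
  exact: measurable_coord.
have q0 i z : (0 <= q i z)%E by rewrite lee_fin; case: ifP => _ //; exact: sqr_ge0.
pose d := t / 2 + c * (k%:R + 2 * enorm F0 ^+ 2 / sigma ^+ 2).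
have d0 : 0 <= d.
  rewrite addr_ge0 ?divr_ge0 ?(ltW t0)// mulr_ge0// addr_ge0//.
  by rewrite divr_ge0 ?sqr_ge0// mulr_ge0// sqr_ge0.
apply: (@le_trans _ _ (\int[G n]_z (d%:E + (c * 2)%:E * \sum_(i < n) q i z))%E).
  apply: ge0_le_integral_nonmeasurable => [z|z]; first exact: g0.
  rewrite mul1mx /g /q sumEFin -EFinM -EFinD lee_fin.
  rewrite -big_mkcond/=; set Z := \sum_(i < n | _) _.
  suff SZ : S (F0 + sigma *: (M^T *m z)) <= 2 * enorm F0 ^+ 2 / sigma ^+ 2 + 2 * Z.
    rewrite /d /c; set Y := S _ in SZ *; set X := _ / sigma ^+ 2 in SZ *.
    have -> : 2 * (e ^+ 2 * (k%:R + Y)) / t = 2 / t * e ^+ 2 * (k%:R + Y).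
      by rewrite mulrAC mulrA mulrAC.
    rewrite -/c; have := ler_wpM2l c0 SZ; lra.
  rewrite -(enorm_orth _ MTM) enorm_sqr /S /Z.
  apply: (@le_trans _ _ (\sum_(i < n | (i < k)%N)
      (2 * (M *m F0) i ord0 ^+ 2 / sigma ^+ 2 + 2 * z i ord0 ^+ 2))).
    apply: ler_sum => i _.
    have -> : (M *m (F0 + sigma *: (M^T *m z))) i ord0 =
        (M *m F0) i ord0 + sigma * z i ord0.
      by rewrite mulmxDr -scalemxAr mulmxA MN mul1mx mxE [X in _ + X]mxE.
    have s20 : 0 < sigma ^+ 2 by rewrite exprn_gt0.
    move: ((M *m F0) i ord0) (z i ord0) => u v.
    rewrite ler_pdivrMr// mulrDl divfK ?gt_eqF//.
    by have := sqr_ge0 (u - sigma * v); nra.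
  rewrite big_split/= -!mulr_sumr lerD2r -mulr_suml ler_pM2r ?invr_gt0 ?exprn_gt0//.
  (* The first k squared coordinates of M F0 sum to at most |M F0|^2 = |F0|^2, so [F0] may lie
     outside the span. *)
  rewrite -mulr_sumr ler_pM2l// [leRHS](bigID (fun i : 'I_n => (i < k)%N))/=.
  by rewrite lerDl sumr_ge0// => i _; exact: sqr_ge0.
rewrite ge0_integralD//; last 2 first.
- by move=> z _; apply: mule_ge0; [rewrite lee_fin mulr_ge0|exact: sume_ge0].
- by apply: measurable_funeM; exact: emeasurable_sum.
rewrite integral_cst_probability ge0_integralZl//; last 3 first.
- exact: emeasurable_sum.
- by move=> z _; exact: sume_ge0.
- by rewrite lee_fin mulr_ge0.
rewrite ge0_integral_sum//.
have qle i : (\int[G n]_z q i z <= (if (i < k)%N then C else 0)%:E)%E.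
  rewrite /q; case: ifP => _; last by rewrite integral0.
  rewrite (std_gaussian_coord i (f := fun x => (x ^+ 2)%:E))//.
    by apply/measurable_EFinP; exact: measurable_funX.
  by move=> x; rewrite lee_fin sqr_ge0.
apply: (@le_trans _ _ (d%:E + (c * 2)%:E * \sum_(i < n) (if (i < k)%N then C else 0)%:E)%E).
  rewrite leeD2l// lee_wpmul2l//; first by rewrite lee_fin mulr_ge0.
  by apply: lee_sum => i _; exact: qle.
rewrite sumEFin -EFinM -EFinD lee_fin -big_mkcond/= -(big_ord_widen n (fun=> C) kn).
rewrite sumr_const card_ord -[C *+ k]mulr_natr /d.
have -> : t / 2 + c * (k%:R + 2 * enorm F0 ^+ 2 / sigma ^+ 2) + c * 2 * (C * k%:R) =
    t / 2 + 2 / t *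
      (e ^+ 2 * (k%:R + 2 * enorm F0 ^+ 2 / sigma ^+ 2 + 2 * (C * k%:R))).
  by rewrite /c; ring.
rewrite lerD2l ler_wpM2l ?divr_ge0 ?(ltW t0)//.
have C0 : 0 <= C.
  by rewrite -lee_fin; apply: le_trans Cle; apply: integral_ge0 => x _;
    rewrite lee_fin sqr_ge0.
have -> : (1 + 2 * C) * (k%:R * sigma ^+ 4 / tau ^+ 4) +
    2 * (enorm F0 * sigma / tau ^+ 2) ^+ 2 =
    (sigma ^+ 2 / tau ^+ 2) ^+ 2 *
    (k%:R + 2 * enorm F0 ^+ 2 / sigma ^+ 2 + 2 * (C * k%:R)).
  by field; rewrite !gt_eqF.
rewrite ler_wpM2r//.
  apply: addr_ge0; last by rewrite !mulr_ge0.
  apply: addr_ge0 => //; rewrite -mulrA mulr_ge0//.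
  by apply: divr_ge0; exact: sqr_ge0.
by rewrite ler_pXn2r// nnegrE ?(ltW e0)// divr_ge0// sqr_ge0.
Qed.

End expected_tv.

Theorem theorem1 (R : realType)
    (sigma tau : nat -> R) (k : nat -> nat)
    (F0 : forall n, 'cV[R]_n) (Phi : forall n, 'M[R]_(n, k n))
    (post : forall n, R.-pker 'cV[R]_n ~> 'cV[R]_n)
    (sigma_gt0 : forall n, (0 < n)%N -> 0 < sigma n)
    (tau_gt0 : forall n, (0 < n)%N -> 0 < tau n)
    (k_bounds : forall n, (0 < n)%N -> (1 <= k n <= n)%N)
    (rank_Phi : forall n, (0 < n)%N -> \rank (Phi n) = k n)
    (postP : forall n, (0 < n)%N ->
      is_posterior (gaussian 0 (tau n ^+ 2 *: hat_mx (Phi n)))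
                   (gaussian_model (sigma n ^+ 2)%:M) (post n))
    (sigma_tau : sigma =o_\oo tau)
    (F0_tau : (fun n => enorm (F0 n)) =o_\oo (fun n => tau n ^+ 2 / sigma n))
    (k_tau : (fun n => (k n)%:R : R) =o_\oo (fun n => tau n ^+ 4 / sigma n ^+ 4)) :
  (\int[gaussian (F0 n) (sigma n ^+ 2)%:M]_y
     tv_dist (post n y)
       (gaussian (hat_mx (Phi n) *m y) (sigma n ^+ 2 *: hat_mx (Phi n))))%E
    @[n --> \oo] --> 0%E.
Proof.
have [C C0 Cle] := @integral_std_normal_sqr_le R.
pose u n : R := (k n)%:R * sigma n ^+ 4 / tau n ^+ 4.
pose v n : R := enorm (F0 n) * sigma n / tau n ^+ 2.
pose B n : R := (1 + 2 * C) * u n + 2 * v n ^+ 2.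
have npos : \forall n \near \oo, (0 < n)%N by exists 1%N.
have u_to0 : u n @[n --> \oo] --> (0 : R).
  apply/cvgr0Pnorm_le => e e0; near=> n.
  have n0 : (0 < n)%N by near: n.
  have := sigma_gt0 n n0; have := tau_gt0 n n0 => t0 s0.
  have : `|(k n)%:R| <= e * `|tau n ^+ 4 / sigma n ^+ 4|.
    by near: n; move/eqoP: k_tau; apply.
  have s4 : 0 < sigma n ^+ 4 by rewrite exprn_gt0.
  have t4 : 0 < tau n ^+ 4 by rewrite exprn_gt0.
  rewrite [X in _ * X]gtr0_norm ?divr_gt0// normr_nat => kle.
  rewrite ger0_norm; last first.
    by apply: divr_ge0; [apply: mulr_ge0 => //; exact: ltW|exact: ltW].
  by rewrite ler_pdivrMr// -ler_pdivlMr// -mulrA.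
have v_to0 : v n @[n --> \oo] --> (0 : R).
  apply/cvgr0Pnorm_le => e e0; near=> n.
  have n0 : (0 < n)%N by near: n.
  have := sigma_gt0 n n0; have := tau_gt0 n n0 => t0 s0.
  have : `|enorm (F0 n)| <= e * `|tau n ^+ 2 / sigma n|.
    by near: n; move/eqoP: F0_tau; apply.
  have t2 : 0 < tau n ^+ 2 by rewrite exprn_gt0.
  have F00 : 0 <= enorm (F0 n) by exact: sqrtr_ge0.
  rewrite [X in _ * X]gtr0_norm ?divr_gt0// ger0_norm// => Fle.
  rewrite ger0_norm; last first.
    by apply: divr_ge0; [apply: mulr_ge0 => //; exact: ltW|exact: ltW].
  by rewrite ler_pdivrMr// -ler_pdivlMr// -mulrA.
have B_to0 : B n @[n --> \oo] --> (0 : R).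
  have -> : 0 = (1 + 2 * C) * 0 + 2 * (0 * 0) :> R by ring.
  apply: cvgD; first by apply: cvgM => //; exact: cvg_cst.
  by apply: cvgM; [exact: cvg_cst|under eq_fun do rewrite expr2; exact: cvgM].
(* With t equal to the square root of B, t / 2 + 2 B / t = (5 / 2) t. *)
have sqrtB_to0 : (5 / 2 * Num.sqrt (B n)) @[n --> \oo] --> (0 : R).
  have -> : 0 = 5 / 2 * Num.sqrt 0 :> R by rewrite sqrtr0 mulr0.
  apply: cvgM; first exact: cvg_cst.
  apply: (continuous_cvg _ _ B_to0).
  exact: sqrt_continuous.
apply: (squeeze_cvge (f := fun=> 0%E)
  (h := fun n => (5 / 2 * Num.sqrt (B n))%:E)).
- near=> n; apply/andP; split; first by apply: integral_ge0 => y _; exact: tv_dist_ge0.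
  have n0 : (0 < n)%N by near: n.
  have s0 := sigma_gt0 n n0; have t0 := tau_gt0 n n0.
  have /andP[k1 kn] := k_bounds n n0.
  have st : sigma n ^+ 2 / tau n ^+ 2 <= 2^-1.
    have : `|sigma n| <= 2^-1 * `|tau n|.
      by near: n; move/eqoP: sigma_tau; apply.
    rewrite !gtr0_norm// => sle; rewrite ler_pdivrMr ?exprn_gt0//; nra.
  (* k >= 1 gives u > 0, hence B > 0, so its square root is an admissible positive [t]; the other
     condition t <= 1 holds for large n as B tends to 0. *)
  have u0 : 0 < u n by rewrite divr_gt0 ?mulr_gt0 ?exprn_gt0 ?ltr0n.
  have B0 : 0 < B n.
    have c0 : 0 < (1 + 2 * C) * u n by apply: mulr_gt0 => //; lra.
    by rewrite /B; have := sqr_ge0 (v n); lra.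
  have B1 : B n <= 1 by apply: ltW; near: n; exact: (cvgr_lt 0 B_to0).
  have sB0 : 0 < Num.sqrt (B n) by rewrite sqrtr_gt0.
  have sB1 : Num.sqrt (B n) <= 1 by rewrite -sqrtr1 ler_sqrt.
  apply: (le_trans (expected_tv_le (F0 n) Cle s0 t0 (rank_Phi n n0) kn
    (postP n n0) st sB0 sB1)).
  rewrite lee_fin -/(u n) -/(v n) -/(B n).
  have BE : B n = Num.sqrt (B n) ^+ 2 by rewrite sqr_sqrtr// ltW.
  rewrite [X in _ / _ * X]BE expr2 mulrA divfK ?gt_eqF//; lra.
- exact: cvg_cst.
- by apply: cvg_EFin; [exact: nearW|exact: sqrtB_to0].
Unshelve. all: by end_near.
Qed.
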